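(* Let $W\in\mathbb{C}^{n\times n}$ be normal with $\|W\|\le1$, let $k\ge1$ and $\varepsilon\le 1/(4k)$, and let $W=W_0,W_1,\dots,W_{k-1}$ be matrices such that for all $i\in[k-1]$, $W_i$ is an $\varepsilon$-normalized SV approximation of $W_{i-1}^2$. Let $P_k$ be a matrix such that $\big\|(I-W^{2^k})^{1/2}\big[P_k-(I-W^{2^k})^+\big](I-W^{2^k})^{1/2}\big\|\le O(k\varepsilon)$, and define for $0\le i<k$: $P_i=\frac12\big[I+(I+W_i)P_{i+1}(I+W_i)\big]$. Then, with $B=((I-W)^{1/2})^*(I-W)^{1/2}$, \[\|P_0(I-W)-I\|_B=\big\|(I-W)^{1/2}\big[P_0-(I-W)^+\big](I-W)^{1/2}\big\|\le O(k^2\varepsilon).\]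
   Context: $\|\cdot\|$ is the spectral norm, $^+$ the Moore–Penrose pseudoinverse. For normal $X=U\Lambda U^*$ ($U$ unitary, $\Lambda$ diagonal with $\|X\|\le1$), $(I-X)^{1/2}=U(I-\Lambda)^{1/2}U^*$ using the principal square root. For PSD $F$, $\|x\|_F=\sqrt{x^*Fx}$ and $\|M\|_F=\sup_{x\ne0}\|Mx\|_F/\|x\|_F$. $\widetilde N$ is an $\varepsilon$-normalized SV approximation of $N$ if $I-NN^*$, $I-N^*N$ are PSD and $|x^*(\widetilde N-N)y|\le\frac{\varepsilon}{4}(x^*(I-NN^* )x+y^*(I-N^*N)y)$ for all $x,y\in\mathbb{C}^n$. The $O(\cdot)$ hide absolute constants. *)

(* Defs.v *)
From HB Require Import structures.
From mathcomp Require Import all_boot all_order all_algebra.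
From mathcomp Require Import complex.
From mathcomp Require Import all_classical all_reals ereal.

Set Implicit Arguments.
Unset Strict Implicit.
Unset Printing Implicit Defensive.

Import Order.TTheory GRing.Theory Num.Theory.

Local Open Scope classical_set_scope.
Local Open Scope ring_scope.
Local Open Scope complex_scope.
Local Open Scope sesquilinear_scope.

Definition qform (R : realType) (n : nat) (F : 'M[R[i]]_n) (x : 'cV[R[i]]_n) :
    R[i] :=
  (x^t* *m F *m x) 0 0.

(* In the order of R[i], [0 <= z] says that z is real and nonnegative, so this
   implies that F is Hermitian. *)
Definition psdmx (R : realType) (n : nat) (F : 'M[R[i]]_n) : Prop :=
  forall x : 'cV[R[i]]_n, 0 <= qform F x.

(* Only meaningful for positive semidefinite F, where [qform F x] is a
   nonnegative real. *)
Definition wnorm (R : realType) (n : nat) (F : 'M[R[i]]_n) (x : 'cV[R[i]]_n) :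
    R :=
  Num.sqrt (complex.Re (qform F x)).

(* F may be singular. Division is that of \bar R, in which the inverse of 0 is
   +oo and 0 * +oo = 0; hence 0 / 0 = 0 and c / 0 = +oo for c > 0: vectors x
   with |x|_F = 0 impose |Mx|_F = 0 and are otherwise ignored.
   For n = 0 the supremum is over the empty set and equals -oo. *)
Definition wmxnorm (R : realType) (n : nat) (F M : 'M[R[i]]_n) : \bar R :=
  ereal_sup [set ((wnorm F (M *m x))%:E / (wnorm F x)%:E)%E |
             x in [set x : 'cV[R[i]]_n | x != 0]].

(* The weight I gives the Euclidean norm on vectors. *)
Definition specnorm (R : realType) (n : nat) (M : 'M[R[i]]_n) : \bar R :=
  wmxnorm 1%:M M.

Definition is_pseudoinverse (R : realType) (n : nat) (A G : 'M[R[i]]_n) :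
    Prop :=
  [/\ A *m G *m A = A, G *m A *m G = G,
      (A *m G)^t* = A *m G & (G *m A)^t* = G *m A].

Lemma is_pseudoinverse_unique (R : realType) (n : nat) (A G H : 'M[R[i]]_n) :
  is_pseudoinverse A G -> is_pseudoinverse A H -> G = H.
Proof.
move=> [g1 g2 g3 g4] [h1 h2 h3 h4].
have AGH : A *m G = A *m H.
  have e : A *m G = (A *m H) *m (A *m G) by rewrite !mulmxA h1.
  rewrite -g3 e trmx_mul map_mxM g3 h3.
  by rewrite !mulmxA g1.
have GHA : G *m A = H *m A.
  have e : G *m A = (G *m A) *m (H *m A).
    by rewrite -mulmxA (mulmxA A) h1.
  rewrite -g4 e trmx_mul map_mxM g4 h4.
  by rewrite -mulmxA (mulmxA A) g1.
by rewrite -g2 GHA -mulmxA AGH mulmxA h2.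
Qed.

Lemma gram_unitmx (C : numClosedFieldType) (m n : nat) (A : 'M[C]_(m, n)) :
  row_free A -> A *m A^t* \in unitmx.
Proof.
move=> Afree; rewrite -row_free_unit; apply/inj_row_free => v vAA0.
have vA0 : v *m A = 0.
  apply/eqP; apply: contraTT isT => /dotmx_is_dotmx.
  by rewrite dotmxE trmx_mul map_mxM !mulmxA -(mulmxA v) vAA0 mul0mx mxE ltxx.
by apply: (row_free_inj Afree); rewrite vA0 mul0mx.
Qed.

Lemma is_pseudoinverse_mulmx (R : realType) (n r : nat) (L : 'M[R[i]]_(n, r))
    (M : 'M[R[i]]_(r, n)) :
  row_free (L^t* ) -> row_free M ->
  is_pseudoinverse (L *m M)
    (M^t* *m invmx (M *m M^t* ) *m invmx (L^t* *m L) *m L^t* ).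
Proof.
move=> /gram_unitmx; rewrite trmxCK => Lu /gram_unitmx Mu.
set X := invmx (M *m _); set Y := invmx (_ *m L).
have XE : M *m M^t* *m X = 1%:M by exact: mulmxV.
have YE : Y *m (L^t* *m L) = 1%:M by exact: mulVmx.
have Xh : X^t* = X by rewrite /X trmx_inv map_invmx trmx_mul map_mxM trmxCK.
have Yh : Y^t* = Y by rewrite /Y trmx_inv map_invmx trmx_mul map_mxM trmxCK.
have AG : L *m M *m (M^t* *m X *m Y *m L^t* ) = L *m Y *m L^t*.
  transitivity (L *m (M *m M^t* *m X) *m Y *m L^t* ); first by rewrite !mulmxA.
  by rewrite XE mulmx1.
have GA : M^t* *m X *m Y *m L^t* *m (L *m M) = M^t* *m X *m M.
  transitivity (M^t* *m X *m (Y *m (L^t* *m L)) *m M); first by rewrite !mulmxA.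
  by rewrite YE mulmx1.
split.
- rewrite AG; transitivity (L *m (Y *m (L^t* *m L)) *m M).
    by rewrite !mulmxA.
  by rewrite YE mulmx1.
- rewrite GA; transitivity (M^t* *m X *m (M *m M^t* *m X) *m Y *m L^t* ).
    by rewrite !mulmxA.
  by rewrite XE mulmx1.
- by rewrite AG !trmx_mul !map_mxM trmxCK Yh mulmxA.
- by rewrite GA !trmx_mul !map_mxM trmxCK Xh mulmxA.
Qed.

Lemma is_pseudoinverse_exists (R : realType) (n : nat) (A : 'M[R[i]]_n) :
  exists G, is_pseudoinverse A G.
Proof.
rewrite -(mulmx_base A); eexists; apply: is_pseudoinverse_mulmx.
  by have := col_base_full A; rewrite /row_free mxrank_map mxrank_tr.
exact: row_base_free.
Qed.

Definition pseudoinverse (R : realType) (n : nat) (A : 'M[R[i]]_n) :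
    'M[R[i]]_n :=
  xget 0 [set G | is_pseudoinverse A G].

Lemma pseudoinverseP (R : realType) (n : nat) (A : 'M[R[i]]_n) :
  is_pseudoinverse A (pseudoinverse A).
Proof.
by rewrite /pseudoinverse; case: xgetP => // /(_ _) nex; have [G /nex] := is_pseudoinverse_exists A.
Qed.

(* (I - X)^{1/2}, from the library's diagonalization of X, which for normal X
   reads X = (spectralmx X)^t* *m diag_mx (spectral_diag X) *m spectralmx X.
   [sqrt1BmxE] shows that any other unitary diagonalization gives the same
   matrix. [sqrtc] is the principal square root; [sqrtC] is not, as it picks
   the root with nonnegative imaginary part. *)
Definition sqrt1Bmx (R : realType) (n : nat) (X : 'M[R[i]]_n) : 'M[R[i]]_n :=
  (spectralmx X)^t* *m diag_mx (map_mx (fun a => sqrtc (1 - a)) (spectral_diag X))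
    *m spectralmx X.

Lemma sqrt1BmxE (R : realType) (n : nat) (X U : 'M[R[i]]_n)
    (d : 'rV[R[i]]_n) :
  U \is unitarymx -> X = U *m diag_mx d *m U^t* ->
  sqrt1Bmx X = U *m diag_mx (map_mx (fun a => sqrtc (1 - a)) d) *m U^t*.
Proof.
move=> Uu XE; set f := fun a => _; set V := spectralmx X.
have Vu : V \is unitarymx := spectral_unitarymx X.
have UU : U^t* *m U = 1%:M by apply: mulmx1C; exact/unitarymxP.
have VV : V^t* *m V = 1%:M by apply: mulmx1C; exact/unitarymxP.
have VV' : V *m V^t* = 1%:M by exact/unitarymxP.
have Xn : X \is normalmx.
  apply/orthomx_spectral_subproof; exists (U^t*, d) => /=.
    by rewrite trmxC_unitary.
  by rewrite invmx_unitary ?trmxC_unitary// trmxCK.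
have /orthomx_spectralP := Xn; rewrite invmx_unitary// -/V => XV.
set e := spectral_diag X in XV.
have Q : V *m U *m diag_mx d = diag_mx e *m (V *m U).
  have : V *m X *m U = V *m X *m U by [].
  rewrite {1}XE {1}XV !mulmxA VV' mul1mx -(mulmxA _ _ U) UU mulmx1.
  by rewrite -(mulmxA _ V U).
have fQ : V *m U *m diag_mx (map_mx f d) = diag_mx (map_mx f e) *m (V *m U).
  move: (V *m U) Q => M /matrixP ME; apply/matrixP => i j.
  move: (ME i j); rewrite !mul_mx_diag !mul_diag_mx !mxE [RHS]mulrC => qE.
  have [->|q0] := eqVneq (M i j) 0; first by rewrite mul0r mulr0.
  by rewrite (mulfI q0 qE) mulrC.
rewrite /sqrt1Bmx -/V -/e -/f.
transitivity (V^t* *m (diag_mx (map_mx f e) *m (V *m U)) *m U^t* ).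
  have UU' : U *m U^t* = 1%:M by exact/unitarymxP.
  by rewrite !mulmxA -(mulmxA _ U) UU' mulmx1.
by rewrite -fQ !mulmxA VV mul1mx.
Qed.

(* The inequality is in the order of R[i]: both sides are real, the right-hand
   one because of the first two conditions. *)
Definition normalized_sv_approx (R : realType) (n : nat) (eps : R)
    (N' N : 'M[R[i]]_n) : Prop :=
  [/\ psdmx (1%:M - N *m N^t* ),
      psdmx (1%:M - N^t* *m N) &
      forall x y : 'cV[R[i]]_n,
        `|(x^t* *m (N' - N) *m y) 0 0| <=
          (eps / 4)%:C * (qform (1%:M - N *m N^t* ) x
                          + qform (1%:M - N^t* *m N) y)].

(* Main.v *)
Require Import Defs.
From mathcomp Require Import all_boot all_order all_algebra.
From mathcomp Require Import ring lra.

Set Implicit Arguments.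
Unset Strict Implicit.
Unset Printing Implicit Defensive.

Import Order.TTheory GRing.Theory Num.Theory.

Local Open Scope ring_scope.
Local Open Scope sesquilinear_scope.

(** Everything is measured by the defect x^*(I - A^*A)x of a contraction A.
    Defects telescope along powers of A, so a perturbation that is small
    relative to defects stays equally small after taking any power; comparing
    the sequence W_0, ..., W_i with its variants in which all steps after the
    j-th are exact squarings then gives ||W_i - W^(2^i)|| = O(i eps) relative
    to the defect of W^(2^i).

    Write N_i = W^(2^i). Unrolling the recursion, P_0 - (I - W)^+ is a sum over
    i < k of one-step errors between the vectors
    x_i = (I + W_(i-1)) ... (I + W_0) (I - W)^(1/2) x and their adjoint
    counterparts, plus the error of P_k. Each one-step error is O(k eps) once
    x_i = 2^(i/2) (I - N_i)^(1/2) w_i with w_i bounded. A step-by-step bound on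
    w_i would lose a factor 1 + O(k eps) at each step, which is too much. The
    telescoping over the hybrid sequences costs only 1 + O(eps) per step,
    because the resulting differences of geometric sums of powers of W_l are
    controlled by the total output energy of the linear system
    h |-> W_l h + e. *)

(** * Elementary real inequalities *)

Section RealLemmas.
Context (R : rcfType).
Implicit Types (a b c : R).

Lemma ler_of_sqr a b : 0 <= b -> a ^+ 2 <= b ^+ 2 -> a <= b.
Proof.
move=> b0 h; case: (lerP a 0) => [a0|a0]; first exact: le_trans b0.
by rewrite -(@ler_pXn2r _ 2%N) // nnegrE ltW.
Qed.

(** Cauchy-Schwarz in the plane for the vectors (sqrt c, a) and (sqrt d, b); it is the induction
    step of [cauchy_schwarz_sum]. *)
Lemma addr_sqrt_mul_le (a b c d : R) : 0 <= c -> 0 <= d ->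
  Num.sqrt c * Num.sqrt d + a * b <=
  Num.sqrt (c + a ^+ 2) * Num.sqrt (d + b ^+ 2).
Proof.
move=> c0 d0; apply: ler_of_sqr; first by rewrite mulr_ge0 ?sqrtr_ge0.
rewrite [leRHS]exprMn !sqr_sqrtr ?addr_ge0 ?sqr_ge0//.
have := sqr_sqrtr c0; have := sqr_sqrtr d0.
move: (Num.sqrt c) (Num.sqrt d) => s t <- <-.
have := sqr_ge0 (s * b - a * t); nra.
Qed.

Lemma cauchy_schwarz_sum (I : Type) (r : seq I) (f g : I -> R) :
  \sum_(i <- r) f i * g i <=
  Num.sqrt (\sum_(i <- r) f i ^+ 2) * Num.sqrt (\sum_(i <- r) g i ^+ 2).
Proof.
elim: r => [|i r IH]; first by rewrite !big_nil sqrtr0 mul0r.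
rewrite !big_cons addrC [f i ^+ 2 + _]addrC [g i ^+ 2 + _]addrC.
apply: le_trans (addr_sqrt_mul_le _ _ _ _); last 2 first.
- by apply: sumr_ge0 => j _; exact: sqr_ge0.
- by apply: sumr_ge0 => j _; exact: sqr_ge0.
by rewrite lerD2r.
Qed.

(** Induction on k, from (1 + a)(1 - (k + 1)a) = 1 - ka - (k + 1)a^2. It bounds (1 + a)^k from above
    once ka is below 1. *)
Lemma bernoulli_inv a k : 0 <= a -> (1 + a) ^+ k * (1 - k%:R * a) <= 1.
Proof.
move=> a0; elim: k => [|k IH]; first by rewrite expr0 mul0r subr0 mulr1.
rewrite exprS mulrAC mulrC; apply: le_trans IH.
apply: ler_wpM2l; first by rewrite exprn_ge0// addr_ge0.
rewrite -natr1; have k0 : 0 <= k%:R :> R by exact: ler0n.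
have := mulr_ge0 (addr_ge0 k0 ler01) (mulr_ge0 a0 a0); nra.
Qed.

Lemma exp1D_le_half a k : 0 <= a -> k%:R * a <= 1 / 2 -> (1 + a) ^+ k <= 2.
Proof.
move=> a0 ka; have := bernoulli_inv k a0.
have : 0 <= (1 + a) ^+ k by rewrite exprn_ge0// addr_ge0.
move: (_ ^+ _) (k%:R * a) ka => x y; nra.
Qed.

(** By Bernoulli 1 + a <= (1 + a/M)^M, so (1 + a)^k <= ((1 + a/M)^k)^M, and the inner power is at
    most 2 by [exp1D_le_half]. *)
Lemma exp1D_le a k M : 0 <= a -> k%:R * a <= M%:R / 2 ->
  (1 + a) ^+ k <= 2 ^+ M.
Proof.
case: M => [|M] a0 ka.
  rewrite mul0r in ka; case: k ka => [|k] ka; first by rewrite !expr0.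
  have -> : a = 0.
    apply: le_anti; rewrite a0 andbT -(@pmulr_rle0 _ k.+1%:R)//; lra.
  by rewrite addr0 expr1n.
have M0 : 0 < M.+1%:R :> R by rewrite ltr0n.
have aM : 0 <= a / M.+1%:R by rewrite divr_ge0// ltW.
have h1 : (1 + a) <= (1 + a / M.+1%:R) ^+ M.+1.
  have bern m : 1 + m%:R * (a / M.+1%:R) <= (1 + a / M.+1%:R) ^+ m.
    elim: m => [|m IH]; first by rewrite mul0r addr0 expr0.
    rewrite exprS -natr1; have m0 : 0 <= m%:R :> R by exact: ler0n.
    move: (a / _) aM (_ ^+ m) IH => t t0 X IH.
    have := ler_wpM2l t0 IH; have := mulr_ge0 m0 (mulr_ge0 t0 t0); nra.
  have := bern M.+1; rewrite mulrCA divff ?mulr1// gt_eqF//.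
apply: (@le_trans _ _ (((1 + a / M.+1%:R) ^+ k) ^+ M.+1)).
  by rewrite exprAC; apply: lerXn2r => //; rewrite nnegrE ?addr_ge0// exprn_ge0// addr_ge0.
apply: lerXn2r; rewrite ?nnegrE// ?exprn_ge0 ?addr_ge0//.
apply: exp1D_le_half => //.
rewrite mulrA ler_pdivrMr//; lra.
Qed.

End RealLemmas.

Section Energy.
Context (R : rcfType) (C : numClosedFieldType).
(* C stands for R[i], with toC the embedding of R and re the real part. *)
Context (toC : {rmorphism R -> C}) (re : C -> R).
Context (toC_le : forall x y, (toC x <= toC y) = (x <= y)).
Context (toC_re : forall z, toC (re z) = 'Re z).

(** * Real parts and moduli *)

Lemma toC_inj : injective toC.
Proof. by move=> x y e; apply: le_anti; rewrite -!toC_le e lexx. Qed.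

Lemma reD (z1 z2 : C) : re (z1 + z2) = re z1 + re z2.
Proof. by apply: toC_inj; rewrite rmorphD /= !toC_re raddfD. Qed.

Lemma reN (z : C) : re (- z) = - re z.
Proof. by apply: toC_inj; rewrite rmorphN /= !toC_re raddfN. Qed.

Lemma re0 : re 0 = 0.
Proof. by apply: toC_inj; rewrite rmorph0 toC_re raddf0. Qed.

Lemma re_sum (I : Type) (r : seq I) (P : pred I) (F : I -> C) :
  re (\sum_(i <- r | P i) F i) = \sum_(i <- r | P i) re (F i).
Proof.
by elim/big_rec2: _ => [|i x y _ <-]; [exact: re0 | rewrite reD].
Qed.

Lemma re_conj (z : C) : re z^* = re z.
Proof. by apply: toC_inj; rewrite !toC_re Re_conj. Qed.

Lemma re_real (z : C) : z \is Num.real -> toC (re z) = z.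
Proof. by move=> zr; rewrite toC_re; apply: Creal_ReP. Qed.

(** Moduli take values in R, so that estimates live in a totally ordered field. *)
Definition modc (z : C) : R := re `|z|.

Lemma modcE (z : C) : toC (modc z) = `|z|.
Proof. exact/re_real/normr_real. Qed.

Lemma modc_ge0 (z : C) : 0 <= modc z.
Proof. by rewrite -toC_le rmorph0 modcE. Qed.

Lemma modcM (z1 z2 : C) : modc (z1 * z2) = modc z1 * modc z2.
Proof. by apply: toC_inj; rewrite rmorphM /= !modcE normrM. Qed.

Lemma modcD (z1 z2 : C) : modc (z1 + z2) <= modc z1 + modc z2.
Proof. by rewrite -toC_le rmorphD /= !modcE ler_normD. Qed.

Lemma modc0 : modc 0 = 0.
Proof. by rewrite /modc normr0 re0. Qed.

Lemma modc_eq0 (z : C) : modc z = 0 -> z = 0.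
Proof. by move=> h; apply/normr0_eq0; rewrite -modcE h rmorph0. Qed.

Lemma modc1 : modc 1 = 1.
Proof. by apply: toC_inj; rewrite modcE normr1 rmorph1. Qed.

Lemma modcN (z : C) : modc (- z) = modc z.
Proof. by rewrite /modc normrN. Qed.

Lemma modcB (z1 z2 : C) : modc (z1 - z2) <= modc z1 + modc z2.
Proof. by rewrite -(modcN z2) modcD. Qed.

Lemma modc_conj (z : C) : modc z^* = modc z.
Proof. by rewrite /modc norm_conjC. Qed.

Lemma modcX z m : modc (z ^+ m) = modc z ^+ m.
Proof. by apply: toC_inj; rewrite rmorphXn /= !modcE normrX. Qed.

Lemma modcV (z : C) : modc z^-1 = (modc z)^-1.
Proof. by apply: toC_inj; rewrite fmorphV /= !modcE normfV. Qed.

Lemma modc_toC x : 0 <= x -> modc (toC x) = x.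
Proof.
move=> x0; apply: toC_inj; rewrite modcE ger0_norm//.
by rewrite -(rmorph0 toC) toC_le.
Qed.

Lemma modc_sum (I : Type) (r : seq I) (P : pred I) (F : I -> C) :
  modc (\sum_(i <- r | P i) F i) <= \sum_(i <- r | P i) modc (F i).
Proof.
elim/big_rec2: _ => [|i x y _ h]; first by rewrite modc0.
by apply: le_trans (modcD _ _) _; rewrite lerD2l.
Qed.

Lemma re_le_modc (z : C) : re z <= modc z.
Proof.
rewrite -toC_le modcE toC_re.
exact: leif_Re_Creal z.
Qed.

Lemma re_ge_modc (z : C) : - modc z <= re z.
Proof. by rewrite lerNl -reN -(modcN z) re_le_modc. Qed.

Lemma modc_sqr (z : C) : modc z ^+ 2 = re (z^* * z).
Proof.
apply: toC_inj; rewrite rmorphXn /= modcE normCKC re_real//.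
by apply: ger0_real; rewrite -normCKC exprn_ge0.
Qed.

(** * Inner products, norms and defects *)

Section Vectors.
Context (n : nat).
Implicit Types (A B E : 'M[C]_n) (x y z : 'cV[C]_n).

Definition sqnorm x : R := \sum_i modc (x i 0) ^+ 2.
Definition dotc x y : C := (x^t* *m y) 0 0.
Definition defect A x : R := sqnorm x - sqnorm (A *m x).
Definition dnorm A x : R := Num.sqrt (defect A x).
Definition contractive A := forall x, 0 <= defect A x.
(** With A = N^* and B = N this is the scale-invariant form of an SV approximation bound: the
    arithmetic mean of the two defects is replaced by their geometric mean. *)
Definition dbound k A B E := forall x y, modc (dotc x (E *m y)) <= k * dnorm A x * dnorm B y.

Lemma dotcE x y : dotc x y = \sum_i (x i 0)^* * y i 0.
Proof. by rewrite /dotc mxE; apply: eq_bigr => i _; rewrite !mxE. Qed.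

Lemma dotc_adj A x y : dotc x (A *m y) = dotc (A^t* *m x) y.
Proof. by rewrite /dotc trmx_mul map_mxM /= trmxCK mulmxA. Qed.

Lemma adjK A : A^t*^t* = A.
Proof. exact: trmxCK. Qed.

Lemma dotc_conj x y : (dotc x y)^* = dotc y x.
Proof.
rewrite !dotcE rmorph_sum /=; apply: eq_bigr => i _.
by rewrite rmorphM /= conjCK mulrC.
Qed.

Lemma modc_dotcC x y : modc (dotc x y) = modc (dotc y x).
Proof. by rewrite -dotc_conj modc_conj. Qed.

Lemma dotcDr x y z : dotc x (y + z) = dotc x y + dotc x z.
Proof. by rewrite /dotc mulmxDr mxE. Qed.

Lemma dotcNr x y : dotc x (- y) = - dotc x y.
Proof. by rewrite /dotc mulmxN mxE. Qed.

Lemma dotcBr x y z : dotc x (y - z) = dotc x y - dotc x z.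
Proof. by rewrite dotcDr dotcNr. Qed.

Lemma dotcDl x y z : dotc (x + y) z = dotc x z + dotc y z.
Proof. by rewrite -[LHS]dotc_conj dotcDr rmorphD /= !dotc_conj. Qed.

Lemma dotcZr x c y : dotc x (c *: y) = c * dotc x y.
Proof. by rewrite /dotc -scalemxAr mxE. Qed.

Lemma dotcZl x c y : dotc (c *: x) y = c^* * dotc x y.
Proof. by rewrite -[LHS]dotc_conj dotcZr rmorphM /= dotc_conj. Qed.

Lemma dotc0r x : dotc x 0 = 0.
Proof. by rewrite /dotc mulmx0 mxE. Qed.

Lemma dotc_sumr x m (F : 'I_m -> 'cV[C]_n) :
  dotc x (\sum_i F i) = \sum_i dotc x (F i).
Proof. by rewrite /dotc mulmx_sumr summxE. Qed.

Lemma sqnorm_dotc x : sqnorm x = re (dotc x x).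
Proof. by rewrite dotcE re_sum; apply: eq_bigr => i _; rewrite modc_sqr. Qed.

Lemma dotcxx x : dotc x x = toC (sqnorm x).
Proof.
rewrite sqnorm_dotc re_real// dotcE ger0_real// sumr_ge0// => i _.
by rewrite -normCKC exprn_ge0.
Qed.

Lemma sqnorm_ge0 x : 0 <= sqnorm x.
Proof. by apply: sumr_ge0 => i _; exact: sqr_ge0. Qed.

Lemma sqnorm_0 : sqnorm 0 = 0.
Proof. by rewrite sqnorm_dotc dotc0r re0. Qed.

Lemma sqnorm_eq0 x : sqnorm x = 0 -> x = 0.
Proof.
move=> /eqP; rewrite psumr_eq0 => [/allP h|i _]; last exact: sqr_ge0.
apply/matrixP => i j; rewrite (ord1 j) mxE; apply: modc_eq0; apply/eqP.
by have := h i (mem_index_enum _); rewrite implyTb sqrf_eq0.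
Qed.

Lemma sqnormD x y : sqnorm (x + y) = sqnorm x + 2 * re (dotc x y) + sqnorm y.
Proof.
rewrite !sqnorm_dotc dotcDl !dotcDr !reD -[dotc y x]dotc_conj re_conj; ring.
Qed.

Lemma sqnormB x y : sqnorm (x - y) = sqnorm x - 2 * re (dotc x y) + sqnorm y.
Proof.
rewrite sqnormD dotcNr reN -scaleN1r [sqnorm (_ *: _)]sqnorm_dotc dotcZr dotcZl rmorphN rmorph1.
by rewrite !mulN1r opprK -sqnorm_dotc mulrN.
Qed.

Lemma sqnormZ c x : sqnorm (c *: x) = modc c ^+ 2 * sqnorm x.
Proof.
by rewrite /sqnorm mulr_sumr; apply: eq_bigr => i _; rewrite mxE modcM exprMn.
Qed.

Lemma modc_dotc_le x y : modc (dotc x y) <= Num.sqrt (sqnorm x) * Num.sqrt (sqnorm y).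
Proof.
rewrite dotcE; apply: le_trans (modc_sum _ _ _) _.
apply: le_trans (cauchy_schwarz_sum _ _ _).
by apply: ler_sum => i _; rewrite modcM modc_conj.
Qed.

Lemma defectZ A c x : defect A (c *: x) = modc c ^+ 2 * defect A x.
Proof. by rewrite /defect -scalemxAr !sqnormZ mulrBr. Qed.

Lemma defect_parallelogram A x y :
  defect A (x + y) + defect A (x - y) = 2 * defect A x + 2 * defect A y.
Proof. by rewrite /defect mulmxDr mulmxBr !sqnormB !sqnormD; ring. Qed.

Lemma defectD_le A x y : contractive A -> defect A (x + y) <= 2 * defect A x + 2 * defect A y.
Proof. by move=> cA; rewrite -defect_parallelogram lerDl; exact: cA. Qed.

Lemma dnorm_ge0 A x : 0 <= dnorm A x.
Proof. exact: sqrtr_ge0. Qed.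

Lemma dnorm_sqr A x : contractive A -> dnorm A x ^+ 2 = defect A x.
Proof. by move=> cA; rewrite sqr_sqrtr. Qed.

Lemma dbound_adj k A B E : dbound k A B E -> dbound k B A (E^t*).
Proof.
move=> h x y; rewrite dotc_adj adjK modc_dotcC.
by apply: le_trans (h y x) _; rewrite mulrAC.
Qed.

(** With y = A^*x, expanding ||x - Ay||^2 >= 0 gives ||x||^2 - ||y||^2 >= ||y||^2 - ||Ay||^2, and
    the right side is a defect of A. *)
Lemma contractive_adj A : contractive A -> contractive (A^t*).
Proof.
move=> cA x; rewrite /defect.
have := cA (A^t* *m x); rewrite /defect.
have := sqnorm_ge0 (x - A *m (A^t* *m x)); rewrite sqnormB dotc_adj -sqnorm_dotc; lra.
Qed.

(** Expand ||x - A^*Ax||^2 >= 0. This charges the weight of A^* at Ax, which the left slot of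
    [dbound] produces, to the weight of A at x. *)
Lemma defect_adj_le A x : defect (A^t*) (A *m x) <= defect A x.
Proof.
rewrite /defect.
have := sqnorm_ge0 (x - A^t* *m (A *m x)); rewrite sqnormB dotc_adj adjK -sqnorm_dotc; lra.
Qed.

Lemma dnorm_adj_le A x : dnorm (A^t*) (A *m x) <= dnorm A x.
Proof. by apply: ler_wsqrtr; exact: defect_adj_le. Qed.

Lemma dnorm_le_sqnorm A x : dnorm A x ^+ 2 <= sqnorm x.
Proof.
(* A negative defect has square root 0 by convention. *)
rewrite /dnorm; have [h|h] := lerP 0 (defect A x).
  by rewrite sqr_sqrtr// gerBl sqnorm_ge0.
by rewrite (ler0_sqrtr (ltW h)) expr2 mulr0 sqnorm_ge0.
Qed.

Lemma sqnorm_dbound x c : 0 <= c -> modc (dotc x x) <= c * Num.sqrt (sqnorm x) -> sqnorm x <= c ^+ 2.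
Proof.
move=> c0; rewrite dotcxx modc_toC ?sqnorm_ge0//; have := sqr_sqrtr (sqnorm_ge0 x).
have := sqrtr_ge0 (sqnorm x); move: (sqnorm x) (Num.sqrt (sqnorm x)) => t s s0 <- h.
have [->|sn] := eqVneq s 0; first by rewrite expr0n sqr_ge0.
apply: lerXn2r; rewrite ?nnegrE//.
by rewrite -(@ler_pM2r _ s) ?lt_def ?sn// -expr2.
Qed.

(** Test the bound at x = Ey: the weight of A at Ey is at most ||Ey||, and one factor ||Ey||
    cancels. *)
Lemma dbound_sqnorm k A B E y : 0 <= k -> dbound k A B E ->
  sqnorm (E *m y) <= (k * dnorm B y) ^+ 2.
Proof.
move=> k0 h; apply: sqnorm_dbound; first by rewrite mulr_ge0// dnorm_ge0.
apply: le_trans (h _ _) _; rewrite mulrAC; apply: ler_wpM2l.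
  by rewrite mulr_ge0// dnorm_ge0.
apply: ler_of_sqr; first exact: sqrtr_ge0.
by rewrite [leRHS]sqr_sqrtr ?sqnorm_ge0// dnorm_le_sqnorm.
Qed.

(** * Powers of contractions and perturbations relative to defects *)

Implicit Types (k kap : R).

Lemma mulmxXS A m : A ^+ m.+1 = A *m A ^+ m.
Proof. by rewrite exprS. Qed.

Lemma mulmxXSr A m : A ^+ m.+1 = A ^+ m *m A.
Proof. by rewrite exprSr. Qed.

Lemma adjD A B : (A + B)^t* = A^t* + B^t*.
Proof. by rewrite linearD /= map_mxD. Qed.

Lemma adjB A B : (A - B)^t* = A^t* - B^t*.
Proof. by rewrite linearB /= map_mxB. Qed.

Lemma adj1 : (1%:M : 'M[C]_n)^t* = 1%:M.
Proof. by rewrite trmx1 map_mx1. Qed.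

Lemma adjM A B : (A *m B)^t* = B^t* *m A^t*.
Proof. by rewrite trmx_mul map_mxM. Qed.

Lemma adjX A m : (A ^+ m)^t* = (A^t*) ^+ m.
Proof.
by elim: m => [|m IH]; rewrite ?expr0 ?adj1// mulmxXS adjM IH -mulmxXSr.
Qed.

Lemma defect_telescope A m x : \sum_(j < m) defect A (A ^+ j *m x) = defect (A ^+ m) x.
Proof.
elim: m => [|m IH].
  by rewrite big_ord0 /defect expr0 mul1mx subrr.
rewrite big_ord_recr /= IH /defect mulmxXS mulmxA; ring.
Qed.

Lemma contractiveX A m : contractive A -> contractive (A ^+ m).
Proof. by move=> cA x; rewrite -defect_telescope sumr_ge0. Qed.

Lemma dnorm_telescope A m x : contractive A ->
  \sum_(j < m) dnorm A (A ^+ j *m x) ^+ 2 = dnorm (A ^+ m) x ^+ 2.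
Proof.
move=> cA; rewrite dnorm_sqr; last exact: contractiveX.
by rewrite -defect_telescope; apply: eq_bigr => j _; rewrite dnorm_sqr.
Qed.

Lemma sum_mulr_le m k (a b : 'I_m -> R) (c d : R) : 0 <= k -> 0 <= c -> 0 <= d ->
  \sum_i a i ^+ 2 <= c ^+ 2 -> \sum_i b i ^+ 2 <= d ^+ 2 ->
  \sum_i k * a i * b i <= k * c * d.
Proof.
move=> k0 c0 d0 ac bd; under eq_bigr do rewrite -mulrA.
rewrite -mulr_sumr -mulrA; apply: ler_wpM2l => //.
apply: le_trans (cauchy_schwarz_sum _ _ _) _.
apply: ler_pM; rewrite ?sqrtr_ge0//.
  by rewrite -(ger0_norm c0) -sqrtr_sqr ler_wsqrtr.
by rewrite -(ger0_norm d0) -sqrtr_sqr ler_wsqrtr.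
Qed.

(** Expand ||Ay||^2 with A = B + E. The cross term is at most 2k times the defect of B at y, by
    [dnorm_adj_le], and ||Ey||^2 is at most k^2 times it. The defect of A is thus at least 1 - 2k -
    k^2 > 1/4 times that of B. *)
Lemma approx_cmp k A B : 0 <= k -> k <= 1 / 8 -> contractive B ->
  dbound k (B^t*) B (A - B) -> contractive A /\ (forall y, dnorm B y <= 2 * dnorm A y).
Proof.
move=> k0 k8 cB h.
have key y : defect B y <= 4 * defect A y.
  have AE : A *m y = B *m y + (A - B) *m y by rewrite -mulmxDl addrC subrK.
  have h1 : re (dotc (B *m y) ((A - B) *m y)) <= k * defect B y.
    apply: le_trans (re_le_modc _) _; apply: le_trans (h _ _) _.
    rewrite -mulrA; apply: ler_wpM2l => //; rewrite -dnorm_sqr// expr2.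
    by apply: ler_wpM2r; [exact: dnorm_ge0 | exact: dnorm_adj_le].
  have h2 : sqnorm ((A - B) *m y) <= k ^+ 2 * defect B y.
    by apply: le_trans (dbound_sqnorm _ k0 h) _; rewrite exprMn dnorm_sqr.
  have := cB y; move: h1 h2; rewrite /defect AE sqnormD.
  move: (re _) (sqnorm _) (sqnorm _) (sqnorm _) => a b c d h1 h2 h3.
  have : k ^+ 2 * (d - c) <= 1 / 8 * (d - c).
    by apply: ler_wpM2r => //; nra.
  have : k * (d - c) <= 1 / 8 * (d - c) by apply: ler_wpM2r.
  move: (k ^+ 2 * _) (k * _) h1 h2 => u v; lra.
have cA : contractive A by move=> y; have := key y; have := cB y; lra.
split=> // y; apply: ler_of_sqr; first by rewrite mulr_ge0// dnorm_ge0.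
by rewrite exprMn !dnorm_sqr//; apply: le_trans (key y) _; rewrite -natrX.
Qed.

(** The mixed weights are those delivered by [dboundX]. If a, b are the weights of A and B at y,
    then a^2 and b^2 differ by at most 2kab + k^2a^2; dividing by the larger weight compares them up
    to 1 + O(k), a factor that can be iterated, unlike the 2 of [approx_cmp]. *)
Lemma mixed_approx_cmp k A B : 0 <= k -> k <= 1 / 4 -> contractive A -> contractive B ->
  dbound k (B^t*) A (A - B) ->
  [/\ forall y, dnorm A y <= (1 + 3 * k) * dnorm B y,
      forall y, dnorm B y <= (1 + 3 * k) * dnorm A y &
      dbound (3 / 2 * k) (B^t*) B (A - B)].
Proof.
move=> k0 k4 cA cB h.
have AE y : A *m y = B *m y + (A - B) *m y by rewrite -mulmxDl addrC subrK.
have h1 y : modc (dotc (B *m y) ((A - B) *m y)) <= k * dnorm B y * dnorm A y.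
  apply: le_trans (h _ _) _; apply: ler_wpM2r; first exact: dnorm_ge0.
  by apply: ler_wpM2l => //; exact: dnorm_adj_le.
have h2 y : sqnorm ((A - B) *m y) <= k ^+ 2 * dnorm A y ^+ 2.
  by rewrite -exprMn; exact: (dbound_sqnorm _ k0 h).
have h3 y : dnorm A y ^+ 2 = dnorm B y ^+ 2 - 2 * re (dotc (B *m y) ((A - B) *m y))
     - sqnorm ((A - B) *m y).
  by rewrite !dnorm_sqr// /defect AE sqnormD; ring.
have AB y : dnorm A y <= (1 + 2 * k) * dnorm B y.
  have := h3 y; have := le_trans (re_ge_modc _) (lexx _) : - modc (dotc (B *m y) ((A - B) *m y)) <= _.
  have := sqnorm_ge0 ((A - B) *m y); have := h1 y; have := dnorm_ge0 A y.
  have := dnorm_ge0 B y; move: (dnorm A y) (dnorm B y) (sqnorm _) (modc _) (re _) => a b e u v.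
  move=> b0 a0 hu e0 huv e1.
  have [ab|ba] := lerP a b; first by have := mulr_ge0 k0 b0; lra.
  have h4 : a * a <= (b + 2 * k * b) * a.
    have : b * b <= b * a by apply: ler_wpM2l => //; exact: ltW.
    nra.
  rewrite mulrDl mul1r; rewrite -(@ler_pM2r _ a)//.
  exact: le_lt_trans ba.
split.
- move=> y; apply: le_trans (AB y) _; apply: ler_wpM2r; first exact: dnorm_ge0.
  by rewrite lerD2l; apply: ler_wpM2r => //; lra.
- move=> y; have := h3 y; have := re_le_modc (dotc (B *m y) ((A - B) *m y)).
  have := h2 y; have := h1 y; have := dnorm_ge0 A y.
  have := dnorm_ge0 B y; move: (dnorm A y) (dnorm B y) (sqnorm _) (modc _) (re _) => a b e u v.
  move=> b0 a0 hu e0 huv e1.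
  have [ab|ba] := lerP b a; first by have := mulr_ge0 k0 a0; lra.
  have kk : k ^+ 2 <= k / 4 by nra.
  have h5 : k ^+ 2 * a ^+ 2 <= k / 4 * (a * b).
    apply: ler_pM => //; rewrite ?sqr_ge0// expr2.
    by apply: ler_wpM2l => //; exact: ltW.
  have h6 : a * a <= a * b by apply: ler_wpM2l => //; exact: ltW.
  have h7 : b * b <= (a + 3 * k * a) * b.
    have := mulr_ge0 k0 (mulr_ge0 a0 b0); nra.
  rewrite mulrDl mul1r; rewrite -(@ler_pM2r _ b)//.
  exact: le_lt_trans ba.
- move=> x y; apply: le_trans (h x y) _.
  have := AB y; have := dnorm_ge0 (B^t*) x; have := dnorm_ge0 B y.
  move: (dnorm A y) (dnorm B y) (dnorm _ x) => a b c b0 c0 ab.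
  have : k * c * a <= k * c * ((1 + 2 * k) * b).
    by apply: ler_wpM2l => //; exact: mulr_ge0.
  move/le_trans; apply.
  have : k * c * b * (1 + 2 * k) <= k * c * b * (3 / 2).
    by apply: ler_wpM2l; [rewrite !mulr_ge0 | lra].
  lra.
Qed.

Lemma exprB_sum A B m :
  A ^+ m - B ^+ m = \sum_(j < m) B ^+ j *m (A - B) *m A ^+ (m - j.+1).
Proof.
elim: m => [|m IH]; first by rewrite big_ord0 !expr0 subrr.
rewrite big_ord_recl /= expr0 mul1mx subSS subn0.
have -> : \sum_(i < m) B ^+ bump 0 i *m (A - B) *m A ^+ (m.+1 - (bump 0 i).+1)
    = B *m (A ^+ m - B ^+ m).
  rewrite IH mulmx_sumr; apply: eq_bigr => i _.
  by rewrite /bump /= add1n subSS mulmxXS !mulmxA.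
by rewrite !mulmxXS mulmxBr mulmxBl addrA subrK.
Qed.

(* Telescoping [A ^+ m - B ^+ m] with [B] on the left and [A] on the right
   makes both energy sums telescope, so that nothing is lost as m grows. *)
Lemma dboundX k A B m : 0 <= k -> contractive A -> contractive B ->
  (forall y, dnorm B y <= 2 * dnorm A y) -> dbound k (B^t*) B (A - B) ->
  dbound (2 * k) ((B ^+ m)^t*) (A ^+ m) (A ^+ m - B ^+ m).
Proof.
move=> k0 cA cB BA h x y; rewrite exprB_sum mulmx_suml dotc_sumr.
apply: le_trans (modc_sum _ _ _) _.
pose a (j : 'I_m) := dnorm (B^t*) ((B^t*) ^+ j *m x).
pose b (j : 'I_m) := dnorm A (A ^+ (m - j.+1) *m y).
apply: (@le_trans _ _ (\sum_j 2 * k * a j * b j)).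
  apply: ler_sum => j _; rewrite -!mulmxA dotc_adj adjX.
  apply: le_trans (h _ _) _; rewrite -/(a j).
  have := BA (A ^+ (m - j.+1) *m y); rewrite -/(b j).
  have : 0 <= k * a j by rewrite mulr_ge0// dnorm_ge0.
  move=> u0 /(ler_wpM2l u0); lra.
rewrite adjX; apply: sum_mulr_le; rewrite ?dnorm_ge0 ?mulr_ge0//.
  by rewrite /a dnorm_telescope//; exact: contractive_adj.
rewrite -dnorm_telescope// (reindex_inj rev_ord_inj) /=.
apply: ler_sum => j _; rewrite /b /= subnSK ?ltn_ord//.
by rewrite subKn// ltnW.
Qed.

(** [dboundX] turns k into 2k with mixed weights, and [mixed_approx_cmp] then gives 3(2k) and
    (3/2)(2k), independently of m. *)
Lemma approxX k A B m : 0 <= k -> k <= 1 / 8 -> contractive B ->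
  dbound k (B^t*) B (A - B) ->
  [/\ forall y, dnorm (A ^+ m) y <= (1 + 6 * k) * dnorm (B ^+ m) y,
      forall y, dnorm (B ^+ m) y <= (1 + 6 * k) * dnorm (A ^+ m) y &
      dbound (3 * k) ((B ^+ m)^t*) (B ^+ m) (A ^+ m - B ^+ m)].
Proof.
move=> k0 k8 cB h; have [cA BA] := approx_cmp k0 k8 cB h.
have k20 : 0 <= 2 * k by rewrite mulr_ge0.
have k24 : 2 * k <= 1 / 4 by lra.
have [h1 h2 h3] := mixed_approx_cmp k20 k24 (contractiveX m cA) (contractiveX m cB)
  (dboundX m k0 cA cB BA h).
split=> [y|y|].
- by rewrite (_ : 6 * k = 3 * (2 * k)) //; ring.
- by rewrite (_ : 6 * k = 3 * (2 * k)) //; ring.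
- by rewrite (_ : 3 * k = 3 / 2 * (2 * k)) //; field.
Qed.

(** * Chains of approximate squarings and their hybrids *)

Definition sv_chain (kap : R) (k : nat) (Ws : nat -> 'M[C]_n) :=
  contractive (Ws 0%N) /\ forall i, (i.+1 < k)%N ->
    dbound kap ((Ws i ^+ 2)^t*) (Ws i ^+ 2) (Ws i.+1 - Ws i ^+ 2).

Lemma sv_chain_adj kap (k : nat) Ws : sv_chain kap k Ws -> sv_chain kap k (fun i => (Ws i)^t*).
Proof.
move=> [h0 h]; split=> [|i ik]; first exact: contractive_adj.
have := dbound_adj (h i ik); by rewrite adjB !adjX adjK.
Qed.

Section Chain.
Context (kap : R) (k : nat) (Ws : nat -> 'M[C]_n).
Context (kap0 : 0 <= kap) (kapk : k%:R * kap <= 1 / 8).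
Context (hW : sv_chain kap k Ws).

Lemma kap8 j : (j < k)%N -> kap <= 1 / 8.
Proof.
move=> jk; apply: le_trans kapk; rewrite ler_peMl// ler1n.
exact: leq_ltn_trans jk.
Qed.

(** A chain prescribes contractivity at index 0; [approx_cmp] propagates it, since the square of a
    contraction is one. *)
Lemma sv_chain_contractive i : (i < k)%N -> contractive (Ws i).
Proof.
elim: i => [|i IH] ik; first by case: hW.
have [] := approx_cmp kap0 (kap8 ik) (contractiveX 2 (IH (ltnW ik))) (hW.2 _ ik).
by [].
Qed.

(** Compares neighbouring hybrids: both reach level i by exact squarings, one from W_(j+1), the
    other from W_j. This is [approxX] for W_(j+1) and W_j^2 with exponent 2^(i-j-1). *)
Lemma sv_chain_step i j : (j < i)%N -> (j.+1 < k)%N ->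
  [/\ forall y, dnorm (Ws j.+1 ^+ (2 ^ (i - j.+1))) y <=
                (1 + 6 * kap) * dnorm (Ws j ^+ (2 ^ (i - j))) y,
      forall y, dnorm (Ws j ^+ (2 ^ (i - j))) y <=
                (1 + 6 * kap) * dnorm (Ws j.+1 ^+ (2 ^ (i - j.+1))) y &
      dbound (3 * kap) ((Ws j ^+ (2 ^ (i - j)))^t*) (Ws j ^+ (2 ^ (i - j)))
        (Ws j.+1 ^+ (2 ^ (i - j.+1)) - Ws j ^+ (2 ^ (i - j)))].
Proof.
move=> ji jk.
have -> : Ws j ^+ (2 ^ (i - j)) = (Ws j ^+ 2) ^+ (2 ^ (i - j.+1)).
  by rewrite -exprM -expnS -subSn.
exact: (approxX _ kap0 (kap8 jk) (contractiveX 2 (sv_chain_contractive (ltnW jk))) (hW.2 _ jk)).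
Qed.

Lemma sv_chain_cmp i j : (j <= i)%N -> (j < k)%N ->
  (forall y, dnorm (Ws j ^+ (2 ^ (i - j))) y <= 4 * dnorm (Ws 0%N ^+ (2 ^ i)) y) /\
  (forall y, dnorm (Ws 0%N ^+ (2 ^ i)) y <= 4 * dnorm (Ws j ^+ (2 ^ (i - j))) y).
Proof.
move=> ji jk.
(* Since 6 j kap <= 3/4, [exp1D_le] applies with M = 2. *)
have pwmx : (1 + 6 * kap) ^+ j <= 4.
  rewrite (_ : 4 = 2 ^+ 2); last by rewrite -natrX.
  apply: exp1D_le; first by rewrite mulr_ge0.
  have : j%:R * kap <= k%:R * kap by rewrite ler_wpM2r// ler_nat ltnW.
  move: kapk; rewrite mulrCA; move: (_ * kap) (_ * kap) => u v; lra.
suff [h1 h2] : (forall y, dnorm (Ws j ^+ (2 ^ (i - j))) y <=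
    (1 + 6 * kap) ^+ j * dnorm (Ws 0%N ^+ (2 ^ i)) y) /\
  (forall y, dnorm (Ws 0%N ^+ (2 ^ i)) y <=
    (1 + 6 * kap) ^+ j * dnorm (Ws j ^+ (2 ^ (i - j))) y).
  split=> y; [apply: le_trans (h1 y) _ | apply: le_trans (h2 y) _];
    by apply: ler_wpM2r => //; exact: dnorm_ge0.
have a0 : 0 <= 1 + 6 * kap by rewrite addr_ge0// mulr_ge0.
elim: j ji jk {pwmx} => [|j IH] ji jk.
  by rewrite subn0; split=> y; rewrite expr0 mul1r.
have [h1 h2] := IH (ltnW ji) (ltnW jk); have [s1 s2 _] := sv_chain_step ji jk.
split=> y.
  apply: le_trans (s1 y) _; rewrite exprS -mulrA; exact: ler_wpM2l.
apply: le_trans (h2 y) _; rewrite exprSr -mulrA.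
by apply: ler_wpM2l; [exact: exprn_ge0 | exact: s2].
Qed.

End Chain.

(** Sum the i hybrid steps: each costs 3 kap, and [sv_chain_cmp] converts each of the two weights to
    that of W_0^(2^i) at a factor 4, whence 48. *)
Lemma sv_chain_close kap (k : nat) Ws i : 0 <= kap -> k%:R * kap <= 1 / 8 ->
  sv_chain kap k Ws -> (i < k)%N ->
  dbound (48 * (k%:R * kap)) ((Ws 0%N ^+ (2 ^ i))^t*) (Ws 0%N ^+ (2 ^ i))
    (Ws i - Ws 0%N ^+ (2 ^ i)).
Proof.
move=> k0 kk hW ik x y.
set p := dnorm _ x; set q := dnorm _ y.
have p0 : 0 <= p by exact: dnorm_ge0.
have q0 : 0 <= q by exact: dnorm_ge0.
suff H j : (j <= i)%N ->
    modc (dotc x ((Ws j ^+ (2 ^ (i - j)) - Ws 0%N ^+ (2 ^ i)) *m y)) <=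
      j%:R * (48 * kap * p * q).
  have := H i (leqnn i); rewrite subnn expn0 expr1 => /le_trans; apply.
  have : i%:R * (48 * kap * p * q) <= k%:R * (48 * kap * p * q).
    by apply: ler_wpM2r; rewrite ?mulr_ge0// ler_nat ltnW.
  lra.
elim: j => [|j IH] ji; first by rewrite subn0 subrr mul0mx dotc0r modc0 mul0r.
have jk : (j.+1 < k)%N by exact: leq_ltn_trans ik.
have [_ _ s3] := sv_chain_step k0 kk hW ji jk.
have [c1 _] := sv_chain_cmp k0 kk hW (ltnW ji) (ltnW jk).
have [c2 _] := sv_chain_cmp k0 kk (sv_chain_adj hW) (ltnW ji) (ltnW jk).
rewrite -[X in X *m y](subrKA (Ws j ^+ (2 ^ (i - j)))) mulmxDl dotcDr.
apply: le_trans (modcD _ _) _; rewrite -natr1 mulrDl mul1r addrC.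
apply: lerD; first exact: IH (ltnW ji).
apply: le_trans (s3 x y) _.
have := c1 y; rewrite -/q; have := c2 x; rewrite -!adjX -/p.
have := dnorm_ge0 (Ws j ^+ (2 ^ (i - j))) y.
have := dnorm_ge0 ((Ws j ^+ (2 ^ (i - j)))^t*) x.
move: (dnorm _ x) (dnorm _ y) => a b a0 b0 ap bq.
have : a * b <= (4 * p) * (4 * q) by apply: ler_pM.
move=> /(ler_wpM2l k0); lra.
Qed.

(** * Geometric sums of powers *)

Definition geom m A := \sum_(t < m) A ^+ t.

Lemma geomS m A : geom m.+1 A = 1%:M + A *m geom m A.
Proof.
rewrite /geom big_ord_recl expr0; congr (_ + _).
by rewrite mulmx_sumr; apply: eq_bigr => i _; rewrite -mulmxXS.
Qed.

Lemma geom0 A : geom 0 A = 0.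
Proof. by rewrite /geom big_ord0. Qed.

Lemma geom1 A : geom 1 A = 1%:M.
Proof. by rewrite geomS geom0 mulmx0 addr0. Qed.

(** Splits off one factor I + A; iterated, it makes geom (2^j) A the product of I + A^(2^t) over t <
    j, the exact counterpart of the products of I + W_t. *)
Lemma geom_double m A : geom (2 * m) A = geom m (A ^+ 2) *m (1%:M + A).
Proof.
elim: m => [|m IH]; first by rewrite muln0 !geom0 mul0mx.
rewrite mulnS !geomS IH expr2 mulmxDl mul1mx.
by rewrite mulmxDr mulmx1 !mulmxA addrA.
Qed.

Lemma geomB_sum A B m :
  geom m A - geom m B = \sum_(j < m) B ^+ j *m (A - B) *m geom (m - j.+1) A.
Proof.
elim: m => [|m IH]; first by rewrite big_ord0 !geom0 subrr.
rewrite big_ord_recl /= expr0 mul1mx subSS subn0.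
have -> : \sum_(i < m) B ^+ bump 0 i *m (A - B) *m geom (m.+1 - (bump 0 i).+1) A
    = B *m (geom m A - geom m B).
  rewrite IH mulmx_sumr; apply: eq_bigr => i _.
  by rewrite /bump /= add1n subSS mulmxXS !mulmxA.
by rewrite !geomS opprD addrACA subrr add0r mulmxBr mulmxBl addrA subrK.
Qed.

(* A dissipation estimate for a contractive linear system: the colligation
   of A is unitary, so the outputs are controlled by the inputs. *)
Lemma response_le A (h e : nat -> 'cV[C]_n) (c : nat -> R) m :
  contractive A -> h 0%N = 0 -> (forall q, h q.+1 = A *m h q + e q) ->
  (forall q, 0 <= c q) ->
  (forall q y, modc (dotc y (e q)) <= c q * dnorm (A^t*) y) ->
  \sum_(q < m) dnorm A (h q) ^+ 2 <= 6 * \sum_(q < m) c q ^+ 2.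
Proof.
move=> cA h0 hS c0 ec.
(* The stored energy ||h_m||^2 is added so that the induction closes. *)
suff H : sqnorm (h m) + 1 / 2 * (\sum_(q < m) dnorm A (h q) ^+ 2) <=
    3 * \sum_(q < m) c q ^+ 2.
  by have := sqnorm_ge0 (h m); move: H; clear; lra.
elim: m => [|m IH]; first by rewrite !big_ord0 h0 sqnorm_0 !mulr0 addr0.
rewrite !big_ord_recr /= hS sqnormD.
have h1 : re (dotc (A *m h m) (e m)) <= c m * dnorm A (h m).
  apply: le_trans (re_le_modc _) _; apply: le_trans (ec _ _) _.
  by apply: ler_wpM2l => //; exact: dnorm_adj_le.
have h2 : sqnorm (e m) <= c m ^+ 2.
  apply: sqnorm_dbound => //; apply: le_trans (ec _ _) _; apply: ler_wpM2l => //.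
  apply: ler_of_sqr; first exact: sqrtr_ge0.
  by rewrite [leRHS]sqr_sqrtr ?sqnorm_ge0// dnorm_le_sqnorm.
have h3 : sqnorm (A *m h m) = sqnorm (h m) - dnorm A (h m) ^+ 2.
  by rewrite dnorm_sqr// /defect; ring.
(* With p the weight of h_m, this says 2cp <= p^2/2 + 2c^2, which absorbs the cross term; ||e_m||^2
   <= c^2 completes the constant 3. *)
have := sqr_ge0 (dnorm A (h m) - 2 * c m).
move: h1 h2 h3 IH; clear; nra.
Qed.

(** * Diagonal matrices and the weights |1 - e_i| *)

Definition gap (e : 'rV[C]_n) i : R := modc (1 - e 0 i).
(** The squared norm of (I - diag e)^(1/2) y. *)
Definition gapnorm (e : 'rV[C]_n) y : R := \sum_i gap e i * modc (y i 0) ^+ 2.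
(* Equivalently, u = (I - diag e)^(1/2) v for some v of norm at most b. *)
Definition gapdual (e : 'rV[C]_n) (u : 'cV[C]_n) (b : R) :=
  (forall i, gap e i = 0 -> u i 0 = 0) /\
  \sum_i modc (u i 0) ^+ 2 / gap e i <= b ^+ 2.

Implicit Types (d e f : 'rV[C]_n) (u : 'cV[C]_n).

Lemma gap_ge0 e i : 0 <= gap e i.
Proof. exact: modc_ge0. Qed.

Lemma gapnorm_ge0 e y : 0 <= gapnorm e y.
Proof. by apply: sumr_ge0 => i _; rewrite mulr_ge0 ?gap_ge0 ?sqr_ge0. Qed.

Lemma diag_mulE e x i : (diag_mx e *m x) i 0 = e 0 i * x i 0.
Proof. by rewrite mul_diag_mx mxE. Qed.

Lemma diagX e m : diag_mx e ^+ m = diag_mx (map_mx (fun z : C => z ^+ m) e).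
Proof.
elim: m => [|m IH].
  by rewrite expr0; apply/matrixP => i j; rewrite !mxE.
rewrite mulmxXS IH mulmx_diag; congr diag_mx.
by apply/rowP => j; rewrite !mxE exprS.
Qed.

Lemma diag_adj e : (diag_mx e)^t* = diag_mx (map_mx (fun z : C => z^*) e).
Proof. by rewrite tr_diag_mx map_diag_mx. Qed.

Lemma defect_diag e x : defect (diag_mx e) x = \sum_i (1 - modc (e 0 i) ^+ 2) * modc (x i 0) ^+ 2.
Proof.
rewrite /defect /sqnorm -sumrB; apply: eq_bigr => i _.
by rewrite diag_mulE modcM exprMn mulrBl mul1r.
Qed.

Lemma defect_diag_adj e x : defect ((diag_mx e)^t*) x = defect (diag_mx e) x.
Proof.
by rewrite diag_adj !defect_diag; apply: eq_bigr => i _; rewrite mxE modc_conj.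
Qed.

Lemma dnorm_diag_adj e x : dnorm ((diag_mx e)^t*) x = dnorm (diag_mx e) x.
Proof. by rewrite /dnorm defect_diag_adj. Qed.

Definition uball e := forall i, modc (e 0 i) <= 1.

Lemma contractive_diag e : uball e -> contractive (diag_mx e).
Proof.
move=> e1 x; rewrite defect_diag sumr_ge0// => i _.
by rewrite mulr_ge0 ?sqr_ge0// subr_ge0 exprn_ile1 ?modc_ge0.
Qed.

Lemma uballX e m : uball e -> uball (map_mx (fun z : C => z ^+ m) e).
Proof. by move=> e1 i; rewrite mxE modcX exprn_ile1 ?modc_ge0. Qed.

(** Uses 1 - |e_i| <= |1 - e_i|. No reverse bound holds on the unit circle, where the defect
    vanishes and the gap need not. *)
Lemma sub1_sqr_le e i : uball e -> 1 - modc (e 0 i) ^+ 2 <= 2 * gap e i.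
Proof.
move=> e1; rewrite /gap; have := e1 i; have := modc_ge0 (e 0 i).
have : 1 <= modc (e 0 i) + modc (1 - e 0 i).
  by apply: le_trans (modcD _ _); rewrite addrC subrK modc1.
by move: (modc (e 0 i)) (modc _) => a b h a0 a1; nra.
Qed.

Lemma dnorm_diag_le e y : uball e -> dnorm (diag_mx e) y <= 2 * Num.sqrt (gapnorm e y).
Proof.
move=> e1; apply: ler_of_sqr; first by rewrite mulr_ge0 ?sqrtr_ge0.
rewrite exprMn dnorm_sqr; last exact: contractive_diag.
rewrite sqr_sqrtr ?gapnorm_ge0// defect_diag /gapnorm mulr_sumr.
apply: ler_sum => i _; have := sub1_sqr_le i e1; have := gap_ge0 e i.
have := sqr_ge0 (modc (y i 0)); move: (modc (y i 0) ^+ 2) (gap e i) => p q p0 q0 h.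
have := ler_wpM2r p0 h; have := mulr_ge0 q0 p0; rewrite -natrX; nra.
Qed.

(** Duality: a test vector supported on one coordinate forces u to vanish where the gap does, and
    the extremal test vector u/gap, with 0^-1 = 0, gives the norm bound. *)
Lemma gapdualI e u (b : R) : 0 <= b ->
  (forall y, modc (dotc y u) <= b * Num.sqrt (gapnorm e y)) -> gapdual e u b.
Proof.
move=> b0 h; split.
  move=> i wi; pose y := \col_j (if j == i then u i 0 else 0) : 'cV[C]_n.
  have := h y.
  have -> : gapnorm e y = 0.
    rewrite /gapnorm big1// => j _; rewrite mxE; case: eqP => [->|_].
      by rewrite wi mul0r.
    by rewrite modc0 expr0n /= mulr0.
  rewrite sqrtr0 mulr0 dotcE (bigD1 i)//= big1 => [|j ji]; last first.
    by rewrite mxE (negbTE ji) rmorph0 mul0r.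
  rewrite mxE eqxx addr0 modcM modc_conj => h1.
  apply: modc_eq0; apply/eqP; rewrite -sqrf_eq0 expr2 eq_le h1.
  by rewrite mulr_ge0 ?modc_ge0.
pose y := \col_j (u j 0 * toC (gap e j)^-1) : 'cV[C]_n.
set Y := \sum_i _.
have Y0 : 0 <= Y by apply: sumr_ge0 => i _; rewrite divr_ge0 ?sqr_ge0 ?gap_ge0.
have e1 : dotc y u = toC Y.
  rewrite dotcE rmorph_sum /=; apply: eq_bigr => i _; rewrite mxE [in LHS]rmorphM [in RHS]rmorphM /=.
  have -> : (toC (gap e i)^-1)^* = toC (gap e i)^-1.
    apply: geC0_conj; rewrite -(rmorph0 toC) toC_le invr_ge0; exact: gap_ge0.
  rewrite modc_sqr re_real 1?mulrAC//.
  by apply: ger0_real; rewrite -normCKC exprn_ge0.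
have e2 : gapnorm e y = Y.
  apply: eq_bigr => i _; rewrite mxE modcM modc_toC ?invr_ge0 ?gap_ge0//.
  have [->|wn] := eqVneq (gap e i) 0; first by rewrite mul0r invr0 mulr0.
  by field.
have := h y; rewrite e1 e2 modc_toC//.
have := sqr_sqrtr Y0; have := sqrtr_ge0 Y.
move: (Y) (Num.sqrt Y) => Z s s0 <- hs.
have [->|sn] := eqVneq s 0; first by rewrite expr0n sqr_ge0.
apply: lerXn2r; rewrite ?nnegrE//.
by rewrite -(@ler_pM2r _ s) ?lt_def ?sn// -expr2.
Qed.

(** Write u_i = sqrt(gap_i) v_i: the map from v is then diagonal, and K bounds its squared
    multiplier in the defect weight. *)
Lemma dnorm_diag_gapdual e e' f u (b K : R) : uball e -> 0 <= K -> gapdual e' u b ->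
  (forall i, gap e' i != 0 ->
    (1 - modc (e 0 i) ^+ 2) * modc (f 0 i) ^+ 2 * gap e' i <= K) ->
  dnorm (diag_mx e) (diag_mx f *m u) ^+ 2 <= K * b ^+ 2.
Proof.
move=> e1 K0 [u0 ub] h; rewrite dnorm_sqr; last exact: contractive_diag.
apply: le_trans (ler_wpM2l K0 ub); rewrite defect_diag mulr_sumr.
apply: ler_sum => i _; rewrite diag_mulE modcM.
have [w0|wn] := eqVneq (gap e' i) 0.
  by rewrite u0// modc0 mulr0 expr0n /= mulr0 mul0r mulr0.
rewrite -(@ler_pM2r _ (gap e' i)) ?lt_def ?wn ?gap_ge0//.
have -> : K * (modc (u i 0) ^+ 2 / gap e' i) * gap e' i = K * modc (u i 0) ^+ 2.
  by field.
have := ler_wpM2r (sqr_ge0 (modc (u i 0))) (h i wn).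
by apply: le_trans; rewrite le_eqVlt; apply/orP; left; apply/eqP; ring.
Qed.

Lemma geom_diag m e : geom m (diag_mx e) = diag_mx (\row_i \sum_(t < m) e 0 i ^+ t).
Proof.
elim: m => [|m IH].
  by rewrite geom0; apply/matrixP => i j; rewrite !mxE big_ord0 mul0rn.
rewrite geomS IH mulmx_diag; apply/matrixP => i j; rewrite !mxE.
case: eqVneq => [->|_]; rewrite ?mulr0n ?mulr1n ?addr0//.
rewrite big_ord_recl expr0 mulr_sumr; congr (_ + _).
by apply: eq_bigr => t _; rewrite exprS.
Qed.

Lemma geom_gap e i m : modc (\sum_(t < m) e 0 i ^+ t) * gap e i = modc (1 - e 0 i ^+ m).
Proof.
rewrite /gap -modcM mulrC; congr modc.
by rewrite -opprB mulNr -subrX1 opprB.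
Qed.

(** With g the scalar geometric sum, the multiplier (1 - |e|^2) |g|^2 gap is at most 2 (|g| gap)^2 =
    2 |1 - e^m|^2 <= 8, uniformly in m. *)
Lemma dnorm_geom_diag e u (b : R) m : uball e -> gapdual e u b ->
  dnorm (diag_mx e) (geom m (diag_mx e) *m u) ^+ 2 <= 8 * b ^+ 2.
Proof.
move=> e1 ub; rewrite geom_diag; apply: (dnorm_diag_gapdual e1 _ ub) => // i wn; rewrite mxE.
have := sub1_sqr_le i e1; have := geom_gap e i m; have := gap_ge0 e i.
have : modc (1 - e 0 i ^+ m) <= 2.
  apply: le_trans (modcB _ _) _; rewrite modc1 modcX.
  have := exprn_ile1 m (modc_ge0 (e 0 i)) (e1 i); move: (_ ^+ _) => a; lra.
have := modc_ge0 (1 - e 0 i ^+ m).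
move: (modc (1 - _)) (modc (\sum_(q < _) _)) (gap e i) (modc _ ^+ 2) => g a w p g0 g2 w0 aw h.
have w1 : 0 <= a ^+ 2 * w by rewrite mulr_ge0// sqr_ge0.
have : (1 - p) * (a ^+ 2 * w) <= 2 * w * (a ^+ 2 * w) by apply: ler_wpM2r.
have -> : 2 * w * (a ^+ 2 * w) = 2 * (a * w) ^+ 2 by ring.
rewrite aw mulrA => /le_trans; apply.
have : g ^+ 2 <= 2 ^+ 2 by apply: lerXn2r; rewrite ?nnegrE.
by rewrite -natrX; move: (g ^+ 2) => z; lra.
Qed.

(** Split geom q A u into geom q N u, bounded by [dnorm_geom_diag], and h_q, which obeys h_(q+1) = A
    h_q + (A - N) geom q N u and is bounded by [response_le]. As 4608 = 24^2 * 8, the total per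
    index is 256 + 12 * 4608 <= 250^2 times b^2. *)
Lemma geom_energy A e u (b del : R) m : uball e -> contractive A ->
  0 <= del -> del <= 6 -> 0 <= b ->
  dbound del ((diag_mx e)^t*) (diag_mx e) (A - diag_mx e) ->
  (forall y, dnorm A y <= 4 * dnorm (diag_mx e) y) ->
  (forall y, dnorm ((diag_mx e)^t*) y <= 4 * dnorm (A^t*) y) ->
  gapdual e u b ->
  \sum_(q < m) dnorm A (geom q A *m u) ^+ 2 <= m%:R * (250 * b) ^+ 2.
Proof.
move=> e1 cA d0 d6 b0 hb AN NA ub; set N := diag_mx e in hb AN NA *.
pose h q := (geom q A - geom q N) *m u.
pose c q := 4 * del * dnorm N (geom q N *m u).
have c0 q : 0 <= c q by rewrite !mulr_ge0 ?dnorm_ge0.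
have hh : \sum_(q < m) dnorm A (h q) ^+ 2 <= 6 * \sum_(q < m) c q ^+ 2.
  apply: (@response_le A h (fun q => (A - N) *m (geom q N *m u))) => //.
  - by rewrite /h !geom0 subrr mul0mx.
  - move=> q; rewrite /h !geomS opprD addrACA subrr add0r !mulmxA -mulmxDl.
    by congr (_ *m u); rewrite mulmxBr mulmxBl addrA subrK.
  move=> q y; apply: le_trans (hb _ _) _; rewrite /c.
  have := NA y; have := dnorm_ge0 N (geom q N *m u).
  move: (dnorm N (_ *m _)) (dnorm _ y) (dnorm _ y) => p r s p0 rs.
  have := ler_wpM2r p0 (ler_wpM2l d0 rs); lra.
have cq q : c q ^+ 2 <= 4608 * b ^+ 2.
  rewrite /c exprMn; have := dnorm_geom_diag q e1 ub; rewrite -/N.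
  move=> pb; rewrite (_ : 4608 * b ^+ 2 = 24 ^+ 2 * (8 * b ^+ 2)); last by ring.
  apply: ler_pM; rewrite ?sqr_ge0//.
  by apply: lerXn2r; rewrite ?nnegrE ?mulr_ge0//; lra.
have hc : \sum_(q < m) c q ^+ 2 <= m%:R * (4608 * b ^+ 2).
  apply: le_trans (ler_sum _ (fun (q : 'I_m) _ => cq q)) _.
  by rewrite sumr_const card_ord -[leLHS]mulr_natl.
apply: (@le_trans _ _ (\sum_(q < m) (256 * b ^+ 2 + 2 * dnorm A (h q) ^+ 2))).
  apply: ler_sum => q _.
  have -> : geom q A *m u = geom q N *m u + h q.
    by rewrite /h mulmxBl addrC subrK.
  have := defectD_le (geom q N *m u) (h q) cA; rewrite -!dnorm_sqr//.
  have : dnorm A (geom q N *m u) ^+ 2 <= 16 * (8 * b ^+ 2).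
    apply: le_trans (_ : (4 * dnorm N (geom q N *m u)) ^+ 2 <= _).
      by apply: lerXn2r; rewrite ?nnegrE ?mulr_ge0 ?dnorm_ge0.
    rewrite exprMn -natrX; apply: ler_wpM2l => //; exact: dnorm_geom_diag.
  move: (dnorm _ _ ^+ 2) (dnorm _ _ ^+ 2) (dnorm _ _ ^+ 2) (b ^+ 2) => x1 x2 x3 x4; lra.
rewrite big_split /= sumr_const card_ord -mulr_sumr -[X in X + _]mulr_natl.
move: hh hc; move: (\sum_(q < _) _) (\sum_(q < _) _) => s1 s2 hh hc.
rewrite exprMn; have : 0 <= m%:R * b ^+ 2 by rewrite mulr_ge0 ?sqr_ge0.
move: hc; rewrite !(mulrCA m%:R); move: (m%:R * _) => z; lra.
Qed.

Definition pwmx d m : 'rV[C]_n := map_mx (fun z : C => z ^+ m) d.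

Lemma sqr_sqrt2X m : (Num.sqrt 2 ^+ m) ^+ 2 = (2 ^ m)%:R :> R.
Proof. by rewrite exprAC sqr_sqrtr// natrX. Qed.

Lemma geom_sum_closed (a : R) j : 1 + a * \sum_(l < j) (1 + a) ^+ l = (1 + a) ^+ j.
Proof.
elim: j => [|j IH]; first by rewrite big_ord0 mulr0 addr0 expr0.
by rewrite big_ord_recr /= mulrDr addrA IH exprS mulrDl mul1r.
Qed.

(** The exact case. In each coordinate, with g the geometric sum and w = |1 - d^(2^j)|, one has
    |g|^2 |f|^2 = |g| w <= 2^j w, since g has 2^j terms of modulus at most 1. *)
Lemma base_gapdual_le d f v j y : uball d -> (forall i, modc (f 0 i) ^+ 2 = gap d i) ->
  modc (dotc y (geom (2 ^ j) (diag_mx d) *m (diag_mx f *m v))) <=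
  Num.sqrt 2 ^+ j * Num.sqrt (sqnorm v) * Num.sqrt (gapnorm (pwmx d (2 ^ j)) y).
Proof.
move=> d1 fd; rewrite geom_diag dotcE; apply: le_trans (modc_sum _ _ _) _.
rewrite mulrAC -mulrA.
pose w i := gap (pwmx d (2 ^ j)) i.
apply: (@le_trans _ _ (Num.sqrt 2 ^+ j *
    \sum_i (Num.sqrt (w i) * modc (y i 0)) * modc (v i 0))).
  rewrite mulr_sumr; apply: ler_sum => i _.
  rewrite !diag_mulE mxE !modcM modc_conj.
  set g := \sum_(t < _) _.
  have g0 : 0 <= modc g by exact: modc_ge0.
  have hg : modc g * modc (f 0 i) <= Num.sqrt 2 ^+ j * Num.sqrt (w i).
    apply: ler_of_sqr; first by rewrite mulr_ge0 ?sqrtr_ge0 ?exprn_ge0 ?sqrtr_ge0.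
    rewrite !exprMn sqr_sqrt2X sqr_sqrtr ?gap_ge0// fd expr2 -mulrA.
    have -> : modc g * gap d i = w i by rewrite geom_gap /w /gap mxE.
    apply: ler_wpM2r; first exact: gap_ge0.
    apply: le_trans (modc_sum _ _ _) _.
    apply: (@le_trans _ _ (\sum_(t < 2 ^ j) 1)).
      by apply: ler_sum => t _; rewrite modcX exprn_ile1 ?modc_ge0.
    by rewrite sumr_const card_ord.
  rewrite [leRHS](_ : _ = modc (y i 0) * ((Num.sqrt 2 ^+ j * Num.sqrt (w i)) * modc (v i 0))); last by ring.
  rewrite [X in _ * X <= _]mulrA; apply: ler_wpM2l; first exact: modc_ge0.
  by apply: ler_wpM2r => //; exact: modc_ge0.
apply: ler_wpM2l; first by rewrite exprn_ge0 ?sqrtr_ge0.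
apply: le_trans (cauchy_schwarz_sum _ _ _) _.
rewrite le_eqVlt; apply/orP; left; apply/eqP; congr (Num.sqrt _ * Num.sqrt _).
by apply: eq_bigr => i _; rewrite exprMn sqr_sqrtr ?gap_ge0.
Qed.

(** * Growth of the products of I + W_j *)

Section Growth.
Context (kap : R) (k : nat) (Ws : nat -> 'M[C]_n) (d : 'rV[C]_n).
Context (kap0 : 0 <= kap) (kapk : k%:R * kap <= 1 / 8).
Context (hW : sv_chain kap k Ws) (d1 : uball d) (W0 : Ws 0%N = diag_mx d).

Let W0X j : Ws 0%N ^+ (2 ^ j) = diag_mx (pwmx d (2 ^ j)).
Proof. by rewrite W0 diagX. Qed.

Lemma del6 : 48 * (k%:R * kap) <= 6.
Proof. by move: kapk; move: (_ * kap) => t; lra. Qed.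

Lemma del0 : 0 <= 48 * (k%:R * kap).
Proof. by rewrite !mulr_ge0. Qed.

Lemma close_diag i : (i < k)%N ->
  dbound (48 * (k%:R * kap)) ((diag_mx (pwmx d (2 ^ i)))^t*) (diag_mx (pwmx d (2 ^ i)))
    (Ws i - diag_mx (pwmx d (2 ^ i))).
Proof. by move=> ik; rewrite -W0X; exact: sv_chain_close. Qed.

(** Telescope by [geomB_sum] and apply Cauchy-Schwarz. The left factors have total energy at most (8
    sqrt(gapnorm))^2, the right ones at most m (250 b)^2 by [geom_energy], and comparing W_l^2 with
    W_(l+1) costs 2: 4000 = 2 * 8 * 250. *)
Lemma hybrid_step l j u (b : R) y : (l.+1 < k)%N -> (l < j)%N -> 0 <= b ->
  gapdual (pwmx d (2 ^ l.+1)) u b ->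
  modc (dotc y ((geom (2 ^ (j - l.+1)) (Ws l.+1) - geom (2 ^ (j - l.+1)) (Ws l ^+ 2)) *m u))
  <= 4000 * kap * (Num.sqrt 2 ^+ (j - l.+1) * b) * Num.sqrt (gapnorm (pwmx d (2 ^ j)) y).
Proof.
move=> lk lj b0 ub; set m := (2 ^ (j - l.+1))%N; set A := Ws l.+1.
pose B := Ws l ^+ 2.
have cA : contractive A by exact: sv_chain_contractive kap0 kapk hW _ lk.
have cB : contractive B by apply: contractiveX; exact: sv_chain_contractive kap0 kapk hW _ (ltnW lk).
have hAB : dbound kap (B^t*) B (A - B) by exact: hW.2.
have [_ BA] := approx_cmp kap0 (kap8 kap0 kapk lk) cB hAB.
have energy : \sum_(q < m) dnorm A (geom q A *m u) ^+ 2 <= m%:R * (250 * b) ^+ 2.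
  apply: (@geom_energy A (pwmx d (2 ^ l.+1)) u b (48 * (k%:R * kap))) => //.
  - exact: uballX.
  - exact: del0.
  - exact: del6.
  - exact: close_diag.
  - move=> z; rewrite -W0X.
    have [h _] := sv_chain_cmp kap0 kapk hW (leqnn _) lk.
    by have := h z; rewrite subnn expn0 expr1.
  - move=> z; rewrite -W0X adjX.
    have [_ h] := sv_chain_cmp kap0 kapk (sv_chain_adj hW) (leqnn _) lk.
    by have := h z; rewrite subnn expn0 expr1.
have Pj : dnorm ((B ^+ m)^t*) y <= 8 * Num.sqrt (gapnorm (pwmx d (2 ^ j)) y).
  have [h _] := sv_chain_cmp kap0 kapk (sv_chain_adj hW) (ltnW lj) (ltnW lk).
  have := h y; rewrite -!adjX W0X dnorm_diag_adj.
  have -> : B ^+ m = Ws l ^+ (2 ^ (j - l)).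
    by rewrite /B /m -exprM -expnS -subSn.
  move=> /le_trans; apply; have := dnorm_diag_le y (uballX (2 ^ j) d1).
  rewrite -/(pwmx _ _); lra.
rewrite geomB_sum mulmx_suml dotc_sumr; apply: le_trans (modc_sum _ _ _) _.
pose a (r : 'I_m) := dnorm (B^t*) ((B^t*) ^+ r *m y).
pose c (r : 'I_m) := dnorm A (geom (m - r.+1) A *m u).
apply: (@le_trans _ _ (\sum_r 2 * kap * a r * c r)).
  apply: ler_sum => r _; rewrite -!mulmxA dotc_adj adjX.
  apply: le_trans (hAB _ _) _; rewrite -/(a r).
  have := BA (geom (m - r.+1) A *m u); rewrite -/(c r).
  have u0 : 0 <= kap * a r by rewrite mulr_ge0// dnorm_ge0.
  by move=> /(ler_wpM2l u0); lra.
have s0 : 0 <= Num.sqrt 2 ^+ (j - l.+1) :> R by rewrite exprn_ge0 ?sqrtr_ge0.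
apply: (@le_trans _ _ (2 * kap * dnorm ((B ^+ m)^t*) y *
    (Num.sqrt 2 ^+ (j - l.+1) * (250 * b)))).
  apply: sum_mulr_le; rewrite ?dnorm_ge0 ?mulr_ge0//.
    by rewrite adjX dnorm_telescope//; exact: contractive_adj.
  rewrite exprMn sqr_sqrt2X (reindex_inj rev_ord_inj) /=.
  apply: le_trans energy; apply: ler_sum => r _; rewrite /c /= subnSK ?ltn_ord//.
  by rewrite subKn// ltnW.
set s := Num.sqrt 2 ^+ _ in s0 *.
have t0 : 0 <= 2 * kap * (s * (250 * b)) by rewrite !mulr_ge0.
by move: (ler_wpM2l t0 Pj); lra.
Qed.

(** Strong induction: apart from the factor 2^(j/2), the bound at j + 1 is X plus a = 4000 kap times
    the sum of the bounds up to j, a recursion that (1 + a)^j solves. Each index thus costs 1 +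
    O(kap) rather than 1 + O(k kap). *)
Lemma growth (X : R) (x : nat -> 'cV[C]_n) : 0 <= X ->
  (forall j, (j < k)%N -> x j.+1 = (1%:M + Ws j) *m x j) ->
  (forall j y, modc (dotc y (geom (2 ^ j) (diag_mx d) *m x 0%N)) <=
    Num.sqrt 2 ^+ j * X * Num.sqrt (gapnorm (pwmx d (2 ^ j)) y)) ->
  forall j, (j <= k)%N ->
    gapdual (pwmx d (2 ^ j)) (x j) (Num.sqrt 2 ^+ j * (X * (1 + 4000 * kap) ^+ j)).
Proof.
move=> X0 xS x0 j; set a := 4000 * kap.
have a0 : 0 <= a by rewrite mulr_ge0.
have s0 p : 0 <= Num.sqrt 2 ^+ p :> R by rewrite exprn_ge0 ?sqrtr_ge0.
have be0 p : 0 <= X * (1 + a) ^+ p by rewrite mulr_ge0// exprn_ge0 ?addr_ge0.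
elim/ltn_ind: j => j IH jk; apply: gapdualI; first by rewrite mulr_ge0.
case: j IH jk => [|j] IH jk y.
  by have := x0 0%N y; rewrite expn0 geom1 mul1mx !expr0 mulr1.
set nw1 := Num.sqrt (gapnorm _ _).
have nw0 : 0 <= nw1 by exact: sqrtr_ge0.
(* The vectors bounded here interpolate between the l = 0 one, built from
   powers of W alone, and the l = j one, which is x j.+1; each step costs one
   [hybrid_step]. *)
have key l : (l <= j)%N -> modc (dotc y (geom (2 ^ (j.+1 - l)) (Ws l) *m x l)) <=
    Num.sqrt 2 ^+ j.+1 * (X * (1 + a * \sum_(t < l.+1) (1 + a) ^+ t)) * nw1.
  elim: l => [|l IHl] lj.
    rewrite subn0 W0; apply: le_trans (x0 _ _) _.
    apply: ler_wpM2r => //; apply: ler_wpM2l => //.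
    rewrite ler_peMr// lerDl mulr_ge0// sumr_ge0// => t _.
    by rewrite exprn_ge0 ?addr_ge0.
  have lk : (l.+1 < k)%N by exact: leq_ltn_trans jk.
  have lj1 : (l < j.+1)%N by exact: ltn_trans lj _.
  have := hybrid_step y lk lj1 (mulr_ge0 (s0 l.+1) (be0 l.+1)) (IH _ _ (ltnW lk)).
  rewrite ltnS => /(_ lj); set D := dotc y _ => hD.
  (* By [geom_double] one factor I + W_l moves from the sum into the vector, so the two hybrids
     differ only by W_(l+1) against W_l^2. *)
  have -> : dotc y (geom (2 ^ (j.+1 - l.+1)) (Ws l.+1) *m x l.+1) =
      dotc y (geom (2 ^ (j.+1 - l)) (Ws l) *m x l) + D.
    rewrite /D mulmxBl dotcBr [in RHS]addrC.
    suff -> : geom (2 ^ (j.+1 - l)) (Ws l) *m x l =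
      geom (2 ^ (j.+1 - l.+1)) (Ws l ^+ 2) *m x l.+1 by rewrite subrK.
    rewrite xS ?(ltnW lk)// mulmxA -geom_double -expnS -subSn//.
  apply: le_trans (modcD _ _) _; rewrite big_ord_recr /=.
  have sE (z : R) : Num.sqrt 2 ^+ (j.+1 - l.+1) * (Num.sqrt 2 ^+ l.+1 * z) =
      Num.sqrt 2 ^+ j.+1 * z :> R by rewrite mulrA -exprD subnK.
  move: (IHl (ltnW lj)) hD; rewrite sE -/a -/nw1.
  move: (modc _) (modc D) (\sum_(t < _) _) (_ ^+ j.+1) ((1 + a) ^+ l.+1).
  by move=> p q r s t; lra.
have := key j (leqnn j); rewrite geom_sum_closed subSn// subnn expn1.
have -> : geom 2 (Ws j) *m x j = x j.+1.
  by rewrite xS// !geomS geom0 mulmx0 addr0 mulmx1.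
by [].
Qed.

End Growth.

(* Since 0^-1 = 0, diag_mx (inv1B e) is the pseudoinverse of I - diag_mx e. *)
Definition inv1B e : 'rV[C]_n := \row_i (1 - e 0 i)^-1.

Lemma gapdual_gap e e' u (b : R) : gap e =1 gap e' -> gapdual e u b -> gapdual e' u b.
Proof.
move=> ee [u0 ub]; split=> [i|]; first by rewrite -ee; exact: u0.
by under eq_bigr do rewrite -ee.
Qed.

Lemma gapdual_factor e f u (b : R) : (forall i, modc (f 0 i) ^+ 2 = gap e i) ->
  gapdual e u b -> exists2 v, u = diag_mx f *m v & sqnorm v <= b ^+ 2.
Proof.
move=> fe [u0 ub]; exists (\col_i (u i 0 / f 0 i)).
  apply/matrixP => i j; rewrite (ord1 j) diag_mulE mxE.
  have [f0|fn] := eqVneq (f 0 i) 0; last by rewrite mulrC divfK.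
  by rewrite f0 mul0r u0// -fe f0 modc0 expr0n.
apply: le_trans ub; apply: ler_sum => i _.
by rewrite mxE modcM exprMn modcV exprVn fe.
Qed.

Lemma gapdual_dnorm_le e u (b : R) : uball e -> 0 <= b -> gapdual e u b ->
  dnorm (diag_mx e) u <= 3 * b.
Proof.
move=> e1 b0 ub; apply: ler_of_sqr; first by rewrite mulr_ge0.
(* A geometric sum of length 1 is I, and 8 <= 3^2. *)
have := dnorm_geom_diag 1 e1 ub; rewrite geom1 mul1mx exprMn -natrX.
by have := sqr_ge0 b; move: (b ^+ 2) (dnorm _ _ ^+ 2) => p q; lra.
Qed.

Lemma sub1_sqr_le_gap2 e i : uball e -> 1 - modc (e 0 i) ^+ 2 <= gap (pwmx e 2) i.
Proof.
move=> e1; rewrite /gap mxE lerBlDl -modcX.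
by apply: le_trans (modcD _ _); rewrite addrC subrK modc1.
Qed.

(** * Error of one step of the recursion *)

Section Step.
Context (e : 'rV[C]_n) (e1 : uball e) (A : 'M[C]_n) (del : R).
Context (del0 : 0 <= del) (del6 : del <= 6).
Let N := diag_mx e.
Let Q2 := diag_mx (inv1B (pwmx e 2)).
Context (hE : dbound del (N^t*) N (A - N)).

(** Agrees with [inv1B e] except at e_i = -1, where the convention 0^-1 = 0 makes it 0. *)
Let r : 'rV[C]_n := \row_i ((1 - e 0 i ^+ 2)^-1 * (1 + e 0 i)).

Let Q2N : Q2 *m (1%:M + N) = diag_mx r.
Proof.
apply/matrixP => i j; rewrite mul_diag_mx !mxE.
by case: eqVneq => [->|_]; rewrite ?mulr1n// !mulr0n addr0 mulr0.
Qed.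

Let NQ2 : (1%:M + N) *m Q2 = diag_mx r.
Proof.
apply/matrixP => i j; rewrite mul_mx_diag !mxE.
by case: eqVneq => [->|_]; rewrite ?mulr1n 1?mulrC// !mulr0n addr0 mulr0.
Qed.

Let r_le i : gap e i != 0 -> (1 - modc (e 0 i) ^+ 2) * modc (r 0 i) ^+ 2 * gap e i <= 2.
Proof.
move=> wn; rewrite mxE.
have en : 1 - e 0 i != 0 by apply: contraNneq wn => h; rewrite /gap h modc0.
have [ep|ep] := eqVneq (1 + e 0 i) 0.
  by rewrite ep mulr0 modc0 expr0n /= mulr0 mul0r.
have -> : (1 - e 0 i ^+ 2)^-1 * (1 + e 0 i) = (1 - e 0 i)^-1.
  have -> : 1 - e 0 i ^+ 2 = (1 - e 0 i) * (1 + e 0 i) by ring.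
  by rewrite invfM mulfVK.
rewrite modcV -/(gap e i) exprVn.
have -> : (1 - modc (e 0 i) ^+ 2) * (gap e i ^+ 2)^-1 * gap e i =
    (1 - modc (e 0 i) ^+ 2) / gap e i by field.
by rewrite ler_pdivrMr ?lt_def ?wn ?gap_ge0// sub1_sqr_le.
Qed.

Let dnorm_r_le u (b : R) : 0 <= b -> gapdual e u b -> dnorm N (diag_mx r *m u) <= 2 * b.
Proof.
move=> b0 ub; apply: ler_of_sqr; first by rewrite mulr_ge0.
have := dnorm_diag_gapdual e1 (ler0n _ 2) ub r_le.
by rewrite exprMn -natrX; have := sqr_ge0 b; move: (b ^+ 2) (dnorm _ _ ^+ 2) => p q; lra.
Qed.

Let dnorm_rc_le u (b : R) : 0 <= b -> gapdual e u b ->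
  dnorm N ((diag_mx r)^t* *m u) <= 2 * b.
Proof.
move=> b0 ub; apply: ler_of_sqr; first by rewrite mulr_ge0.
rewrite diag_adj; have := dnorm_diag_gapdual (f := map_mx (fun z : C => z^*) r) e1 (ler0n _ 2) ub.
have h i : gap e i != 0 -> (1 - modc (e 0 i) ^+ 2) *
    modc ((map_mx (fun z : C => z^*) r) 0 i) ^+ 2 * gap e i <= 2%:R.
  move=> wn; have -> : (map_mx (fun z : C => z^*) r) 0 i = (r 0 i)^* by rewrite mxE.
  by rewrite modc_conj; exact: r_le.
move=> /(_ h).
by rewrite exprMn -natrX; have := sqr_ge0 b; move: (b ^+ 2) (dnorm _ _ ^+ 2) => p q; lra.
Qed.

(** Serves the quadratic term E Q2 E, with E = A - N. By 1 - |e|^2 <= |1 - e^2|, Eu is dual to the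
    gaps of N^2; Q2 divides by these gaps, and the same inequality leads back to the defect of N. *)
Let dnorm_EQE u : dnorm N (Q2 *m ((A - N) *m u)) <= del * dnorm N u.
Proof.
have c0 : 0 <= del * dnorm N u by rewrite mulr_ge0 ?dnorm_ge0.
have hd : gapdual (pwmx e 2) ((A - N) *m u) (del * dnorm N u).
  apply: gapdualI => // y; apply: le_trans (hE _ _) _; rewrite mulrAC.
  apply: ler_wpM2l => //; rewrite dnorm_diag_adj; apply: ler_wsqrtr.
  rewrite defect_diag; apply: ler_sum => i _; apply: ler_wpM2r; first exact: sqr_ge0.
  exact: sub1_sqr_le_gap2.
apply: ler_of_sqr => //.
have := dnorm_diag_gapdual (f := inv1B (pwmx e 2)) e1 ler01 hd; rewrite mul1r; apply.
move=> i wn; rewrite mxE modcV -/(gap (pwmx e 2) i) exprVn.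
have -> : (1 - modc (e 0 i) ^+ 2) * (gap (pwmx e 2) i ^+ 2)^-1 * gap (pwmx e 2) i =
    (1 - modc (e 0 i) ^+ 2) / gap (pwmx e 2) i by field.
by rewrite ler_pdivrMr ?lt_def ?wn ?gap_ge0// mul1r sub1_sqr_le_gap2.
Qed.

(** Coordinatewise 1 + (1 + e)/(1 - e) = 2/(1 - e). At e = -1 the middle term is 0 and both sides
    are 1/2; at e = 1 they differ, but u vanishes there. *)
Let exact_step u (b : R) : gapdual e u b ->
  (2^-1 *: (1%:M + (1%:M + N) *m Q2 *m (1%:M + N)) - diag_mx (inv1B e)) *m u = 0.
Proof.
move=> [u0 _]; rewrite NQ2.
have -> : 2^-1 *: (1%:M + diag_mx r *m (1%:M + N)) - diag_mx (inv1B e) =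
    diag_mx (\row_i (2^-1 * (1 + r 0 i * (1 + e 0 i)) - (1 - e 0 i)^-1)).
  apply/matrixP => i j; rewrite mul_diag_mx !mxE.
  case: eqVneq => [->|_]; rewrite ?mulr1n// !mulr0n !addr0 mulr0 add0r.
  by rewrite mulr0 subr0.
apply/matrixP => i j; rewrite (ord1 j) diag_mulE !mxE.
have [w0|wn] := eqVneq (gap e i) 0; first by rewrite u0// mulr0.
have en : 1 - e 0 i != 0 by apply: contraNneq wn => h; rewrite /gap h modc0.
suff -> : 2^-1 * (1 + (1 - e 0 i ^+ 2)^-1 * (1 + e 0 i) * (1 + e 0 i)) =
  (1 - e 0 i)^-1 by rewrite subrr mul0r.
have [ep|ep] := eqVneq (1 + e 0 i) 0.
  rewrite ep mulr0 addr0 mulr1; congr (_^-1).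
  have -> : e 0 i = -1 by apply/eqP; rewrite -addr_eq0 addrC ep.
  by rewrite opprK.
have -> : (1 - e 0 i ^+ 2)^-1 * (1 + e 0 i) = (1 - e 0 i)^-1.
  have -> : 1 - e 0 i ^+ 2 = (1 - e 0 i) * (1 + e 0 i) by ring.
  by rewrite invfM mulfVK.
by field.
Qed.

(** With E = A - N, the deviation from the exact step is half of E r + r E + E Q2 E. The terms cost
    6 del, 6 del and 9 del^2 <= 54 del. *)
Lemma step_error x z (b c : R) : 0 <= b -> 0 <= c -> gapdual e x b -> gapdual e z c ->
  modc (dotc z ((2^-1 *: (1%:M + (1%:M + A) *m Q2 *m (1%:M + A))
     - diag_mx (inv1B e)) *m x)) <= 33 * del * (b * c).
Proof.
move=> b0 c0 xb zc; have := hE; have := dnorm_EQE x; set E := A - N => PE hE'.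
have -> : (2^-1 *: (1%:M + (1%:M + A) *m Q2 *m (1%:M + A)) - diag_mx (inv1B e))
   *m x = 2^-1 *: (E *m (diag_mx r *m x) + diag_mx r *m (E *m x)
      + E *m (Q2 *m (E *m x))).
  rewrite -[RHS]add0r -(exact_step xb).
  have -> : 1%:M + A = (1%:M + N) + E by rewrite /E -addrA [N + _]addrC subrK.
  rewrite !mulmxA -!mulmxDl scalemxAl -mulmxDl; congr (_ *m x).
  have -> : E *m diag_mx r = E *m Q2 *m (1%:M + N) by rewrite -Q2N mulmxA.
  have -> : diag_mx r *m E = (1%:M + N) *m Q2 *m E by rewrite NQ2.
  rewrite [RHS]addrAC -scalerDr; congr (_ - _); congr (_ *: _).
  rewrite -[RHS]addrA; congr (_ + _); move: (1%:M + N) => U.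
  by rewrite (mulmxDl U E) mulmxDr !mulmxDl -!addrA.
rewrite dotcZr modcM modcV.
have -> : modc (2 : C) = 2 by rewrite -(rmorph_nat toC) modc_toC.
have h1 : modc (dotc z (E *m (diag_mx r *m x))) <= del * (3 * c) * (2 * b).
  apply: le_trans (hE' _ _) _; rewrite dnorm_diag_adj -[leLHS]mulrA -[leRHS]mulrA; apply: ler_wpM2l => //.
  apply: ler_pM; rewrite ?dnorm_ge0 ?gapdual_dnorm_le//; exact: dnorm_r_le.
have h2 : modc (dotc z (diag_mx r *m (E *m x))) <= del * (2 * c) * (3 * b).
  rewrite dotc_adj; apply: le_trans (hE' _ _) _.
  rewrite dnorm_diag_adj -[leLHS]mulrA -[leRHS]mulrA; apply: ler_wpM2l => //.
  by apply: ler_pM; rewrite ?dnorm_ge0 ?gapdual_dnorm_le//; exact: dnorm_rc_le.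
have h3 : modc (dotc z (E *m (Q2 *m (E *m x)))) <= del * (3 * c) * (del * (3 * b)).
  apply: le_trans (hE' _ _) _; rewrite dnorm_diag_adj -[leLHS]mulrA -[leRHS]mulrA; apply: ler_wpM2l => //.
  apply: ler_pM; rewrite ?dnorm_ge0 ?gapdual_dnorm_le//.
  apply: le_trans PE _; apply: ler_wpM2l => //; exact: gapdual_dnorm_le.
have bc0 : 0 <= del * (b * c) by rewrite !mulr_ge0.
have := ler_wpM2r bc0 del6; rewrite !dotcDr.
move: (modcD (dotc z (E *m (diag_mx r *m x)) + dotc z (diag_mx r *m (E *m x))) (dotc z (E *m (Q2 *m (E *m x))))).
move: (modcD (dotc z (E *m (diag_mx r *m x))) (dotc z (diag_mx r *m (E *m x)))).
move: h1 h2 h3 bc0.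
move: (modc _) (modc _) (modc _) (modc _) (modc _) => n1 n2 n3 n4 n5.
rewrite [2^-1 * _]mulrC ler_pdivrMr//; lra.
Qed.

End Step.

(* Locked, so that no conversion test unfolds the power. *)
Definition core_const : R := locked (2 ^+ 2000).

Lemma core_const_gt0 : 0 < core_const.
Proof. by rewrite /core_const -lock exprn_gt0. Qed.

(** * Unrolling the recursion in the diagonal case *)

Section Core.
Context (kap : R) (k : nat) (Ws Ps : nat -> 'M[C]_n) (d f fk : 'rV[C]_n) (cK : R).
Context (kap0 : 0 <= kap) (kapk : k%:R * kap <= 1 / 8).
Context (hW : sv_chain kap k Ws) (d1 : uball d) (W0 : Ws 0%N = diag_mx d).
Context (fE : forall i, modc (f 0 i) ^+ 2 = gap d i).
Context (fkE : forall i, modc (fk 0 i) ^+ 2 = gap (pwmx d (2 ^ k)) i).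
Context (cK0 : 0 <= cK).
Let Q j := diag_mx (inv1B (pwmx d (2 ^ j))).
Context (hK : forall z v,
  modc (dotc z (diag_mx fk *m (Ps k - Q k) *m diag_mx fk *m v)) <=
    cK * (Num.sqrt (sqnorm z) * Num.sqrt (sqnorm v))).
Context (PS : forall i, (i < k)%N ->
  Ps i = 2^-1 *: (1%:M + (1%:M + Ws i) *m Ps i.+1 *m (1%:M + Ws i))).

Fixpoint iter1D (Vs : nat -> 'M[C]_n) (x : 'cV[C]_n) j :=
  if j is i.+1 then (1%:M + Vs i) *m iter1D Vs x i else x.

Let cj e : 'rV[C]_n := map_mx (fun z : C => z^*) e.

Let gap_cj m : gap (pwmx (cj d) m) =1 gap (pwmx d m).
Proof.
by move=> i; rewrite /gap !mxE -[RHS]modc_conj rmorphB rmorph1 rmorphXn.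
Qed.

Let gap_cj1 t : gap (cj d) t = gap d t.
Proof. by rewrite /gap mxE -[LHS]modc_conj rmorphB rmorph1 /= conjCK. Qed.

(** Each of the k levels contributes a [step_error] 33 del with del = 48 k kap, and 33 * 48 = 1584;
    [core_const] dominates (1 + 4000 kap)^(2k), the loss in the bounds on x_j and y_j together. *)
Theorem core_bound z v :
  modc (dotc z (diag_mx f *m (Ps 0%N - Q 0) *m diag_mx f *m v)) <=
    core_const * (cK + 1584 * k%:R * (k%:R * kap)) *
    (Num.sqrt (sqnorm z) * Num.sqrt (sqnorm v)).
Proof.
set X := Num.sqrt (sqnorm v); set Z := Num.sqrt (sqnorm z).
have X0 : 0 <= X by exact: sqrtr_ge0.
have Z0 : 0 <= Z by exact: sqrtr_ge0.
set a := 4000 * kap; have a0 : 0 <= a by rewrite mulr_ge0.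
pose x := iter1D Ws (diag_mx f *m v).
pose y := iter1D (fun i => (Ws i)^t*) (diag_mx (cj f) *m z).
have xb j : (j <= k)%N ->
    gapdual (pwmx d (2 ^ j)) (x j) (Num.sqrt 2 ^+ j * (X * (1 + a) ^+ j)).
  move=> jk; apply: (growth kap0 kapk hW d1 W0 X0) => // i w.
  exact: base_gapdual_le.
have yb j : (j <= k)%N ->
    gapdual (pwmx d (2 ^ j)) (y j) (Num.sqrt 2 ^+ j * (Z * (1 + a) ^+ j)).
  (* The adjoint chain starts from the conjugate diagonal, which has the same gaps. *)
  move=> jk; apply: (gapdual_gap (gap_cj _)).
  have d1' : uball (cj d) by move=> i; rewrite mxE modc_conj.
  apply: (growth kap0 kapk (sv_chain_adj hW) d1' _ Z0) => //.
    by rewrite W0 diag_adj.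
  move=> i w; apply: base_gapdual_le => // t.
  by rewrite gap_cj1 mxE modc_conj fE.
pose be := (1 + a) ^+ k.
have be1 j : (j <= k)%N -> (1 + a) ^+ j <= be.
  by move=> jk; apply: ler_weXn2l => //; rewrite lerDl.
have be0 j : 0 <= (1 + a) ^+ j by rewrite exprn_ge0// addr_ge0.
have beP : 0 <= be by exact: be0.
(* Here 4000 k kap <= 500, so [exp1D_le] applies with M = 1000. *)
have beM : be <= 2 ^+ 1000.
  apply: exp1D_le => //; rewrite /a mulrCA.
  by move: kapk; move: (_ * kap) => t; lra.
have s0 p : 0 <= Num.sqrt 2 ^+ p :> R by rewrite exprn_ge0 ?sqrtr_ge0.
have bc j c : 0 <= c -> (j <= k)%N -> c * ((Num.sqrt 2 ^+ j * (X * (1 + a) ^+ j)) *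
    (Num.sqrt 2 ^+ j * (Z * (1 + a) ^+ j))) <= 2 ^+ j * (c * (be ^+ 2 * (Z * X))).
  move=> c0 jk; rewrite [leLHS](_ : _ = (Num.sqrt 2 ^+ j) ^+ 2 *
    (c * (((1 + a) ^+ j) ^+ 2 * (Z * X)))); last by ring.
  rewrite sqr_sqrt2X natrX; apply: ler_wpM2l; first exact: exprn_ge0.
  apply: ler_wpM2l => //; apply: ler_wpM2r; first exact: mulr_ge0.
  by apply: lerXn2r; rewrite ?nnegrE ?be1.
(* D_j is D_(j+1)/2 plus a step error; the 1/2 compensates the growth by sqrt 2 of each of the
   bounds on x_j and y_j. *)
pose D j := dotc (y j) ((Ps j - Q j) *m x j).
set del := 48 * (k%:R * kap).
have dl0 : 0 <= del by rewrite !mulr_ge0.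
have DS j : (j < k)%N ->
    modc (D j) <= modc (D j.+1) / 2 + 2 ^+ j * (33 * del * (be ^+ 2 * (Z * X))).
  move=> jk.
  have -> : D j = 2^-1 * D j.+1 + dotc (y j) ((2^-1 *: (1%:M + (1%:M + Ws j) *m
      Q j.+1 *m (1%:M + Ws j)) - Q j) *m x j).
    rewrite /D /=.
    have -> : dotc ((1%:M + (Ws j)^t*) *m y j) ((Ps j.+1 - Q j.+1) *m ((1%:M + Ws j) *m x j))
        = dotc (y j) (((1%:M + Ws j) *m (Ps j.+1 - Q j.+1) *m (1%:M + Ws j)) *m x j).
      have -> : 1%:M + (Ws j)^t* = (1%:M + Ws j)^t* by rewrite adjD adj1.
      by rewrite -dotc_adj !mulmxA.
    rewrite -dotcZr -dotcDr scalemxAl -mulmxDl; congr (dotc _ (_ *m _)).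
    rewrite (PS jk) addrA; congr (_ - _); rewrite -scalerDr; congr (_ *: _).
    by rewrite addrCA mulmxBr mulmxBl subrK.
  apply: le_trans (modcD _ _) _; apply: lerD.
    rewrite modcM modcV; have -> : modc (2 : C) = 2 by rewrite -(rmorph_nat toC) modc_toC.
    by rewrite mulrC.
  apply: le_trans (bc j _ _ (ltnW jk)); last by rewrite mulr_ge0.
  have -> : Q j.+1 = diag_mx (inv1B (pwmx (pwmx d (2 ^ j)) 2)).
    rewrite /Q; congr (diag_mx (inv1B _)); apply/rowP => i.
    by rewrite !mxE expnSr exprM.
  apply: step_error => //.
  - exact: uballX.
  - by move: kapk; rewrite /del; move: (_ * kap) => t; lra.
  - exact: close_diag.
  - by rewrite !mulr_ge0.
  - by rewrite !mulr_ge0.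
  - exact: xb (ltnW jk).
  - exact: yb (ltnW jk).
set K := 33 * del * (be ^+ 2 * (Z * X)) in DS.
have D0 j : (j <= k)%N -> modc (D 0%N) <= modc (D j) / 2 ^+ j + j%:R * K.
  elim: j => [|j IH] jk; first by rewrite expr0 divr1 mul0r addr0.
  apply: le_trans (IH (ltnW jk)) _; rewrite -[j.+1%:R]natr1 mulrDl mul1r.
  rewrite [leRHS]addrCA [leLHS]addrC lerD2l.
  have p0 : 0 < 2 ^+ j :> R by rewrite exprn_gt0.
  have := DS j jk; rewrite -(@ler_pM2r _ (2 ^+ j)^-1) ?invr_gt0// => h.
  apply: le_trans h _; rewrite exprS invfM.
  by rewrite mulrDl -mulrA [2 ^+ j * K]mulrC mulfK ?gt_eqF.
(* x_k and y_k factor through fk and its conjugate, which brings in the hypothesis on P_k. *)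
have Dk : modc (D k) <= 2 ^+ k * (cK * (be ^+ 2 * (Z * X))).
  apply: le_trans (bc k _ cK0 (leqnn k)).
  have [v' xv' v'b] := gapdual_factor fkE (xb k (leqnn k)).
  have fkE' i : modc ((cj fk) 0 i) ^+ 2 = gap (pwmx d (2 ^ k)) i by rewrite mxE modc_conj fkE.
  have [z' yz' z'b] := gapdual_factor fkE' (yb k (leqnn k)).
  rewrite /D xv' yz' -diag_adj -dotc_adj !mulmxA.
  apply: le_trans (hK _ _) _; apply: ler_wpM2l => //; rewrite mulrC.
  apply: ler_pM; rewrite ?sqrtr_ge0//; apply: ler_of_sqr;
    rewrite ?sqr_sqrtr ?sqnorm_ge0// !mulr_ge0//.
have -> : dotc z (diag_mx f *m (Ps 0%N - Q 0) *m diag_mx f *m v) = D 0%N.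
  by rewrite /D /y /x /= -(diag_adj f) -dotc_adj !mulmxA.
apply: le_trans (D0 k (leqnn k)) _.
have p0 : 0 < 2 ^+ k :> R by rewrite exprn_gt0.
have : modc (D k) / 2 ^+ k <= cK * (be ^+ 2 * (Z * X)).
  by rewrite ler_pdivrMr// mulrC.
have be2 : be ^+ 2 <= core_const.
  rewrite /core_const -lock (_ : 2000%N = (1000 * 2)%N)// exprM; apply: lerXn2r; rewrite ?nnegrE//.
  exact: exprn_ge0.
have zx0 : 0 <= Z * X by rewrite mulr_ge0.
have c20 : 0 <= cK + k%:R * (33 * del) by rewrite addr_ge0// !mulr_ge0.
have := ler_wpM2r (mulr_ge0 c20 zx0) be2; rewrite /K /del.
move: core_const (be ^+ 2) (Z * X) (modc (D k) / _) => b2 b1 zx q.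
by move=> h1 h2; lra.
Qed.
End Core.

(** * From quadratic forms to scale-invariant bounds *)

Lemma qform_defect A x : (x^t* *m (1%:M - A *m A^t*) *m x) 0 0 = toC (defect (A^t*) x).
Proof.
rewrite -mulmxA -/(dotc x _) mulmxBl mul1mx dotcBr -mulmxA dotc_adj !dotcxx.
by rewrite -rmorphB.
Qed.

(** Rescale x by sqrt t and y by 1/sqrt t. With weights a, b, the choice t = b/a turns t a^2 + b^2/t
    into 2ab; if a or b is 0, t tends to a limit instead, and for k < 0 the inequality of means
    suffices at t = 1. *)
Lemma dbound_homogeneous A B E k : contractive A -> contractive B ->
  (forall x y, modc (dotc x (E *m y)) <= k / 2 * (defect A x + defect B y)) -> dbound k A B E.
Proof.
move=> cA cB h x y.
have ht t : 0 < t -> modc (dotc x (E *m y)) <= k / 2 * (t * defect A x + t^-1 * defect B y).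
  move=> t0; have := h (toC (Num.sqrt t) *: x) (toC (Num.sqrt t)^-1 *: y).
  rewrite -scalemxAr dotcZl dotcZr !modcM modc_conj !defectZ.
  rewrite !modc_toC ?invr_ge0 ?sqrtr_ge0// exprVn sqr_sqrtr ?(ltW t0)//.
  by rewrite mulrA divff ?mul1r// gt_eqF// sqrtr_gt0.
have := dnorm_sqr x cA; have := dnorm_sqr y cB; have := dnorm_ge0 A x; have := dnorm_ge0 B y.
move: (dnorm A x) (dnorm B y) => a b b0 a0 Eb Ea.
have [k0|k0] := lerP 0 k; last first.
  have := ht 1 ltr01; rewrite invr1 !mul1r -Ea -Eb => h1.
  have := modc_ge0 (dotc x (E *m y)).
  have := sqr_ge0 (a - b); have := mulr_ge0 a0 b0.
  move=> ab0 sq n0; apply: le_trans h1 _; nra.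
move: ht; rewrite -Ea -Eb; move: (modc _) (modc_ge0 (dotc x (E *m y))) => c c0 ht.
(* For c > 0, t = (c/2)/(k s^2/2 + 1) would give c <= c/2. *)
have small (s : R) : 0 <= s -> (forall t, 0 < t -> c <= k / 2 * (t * s ^+ 2)) -> c <= 0.
  move=> s0 hs; rewrite leNgt; apply/negP => cp.
  have q0 : 0 < k / 2 * s ^+ 2 + 1 by rewrite ltr_wpDl// mulr_ge0 ?sqr_ge0// divr_ge0.
  have := hs (c / 2 / (k / 2 * s ^+ 2 + 1)) (divr_gt0 (divr_gt0 cp (ltr0Sn _ _)) q0).
  have -> : k / 2 * (c / 2 / (k / 2 * s ^+ 2 + 1) * s ^+ 2) =
      c / 2 * (k / 2 * s ^+ 2 / (k / 2 * s ^+ 2 + 1)) by ring.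
  have : k / 2 * s ^+ 2 / (k / 2 * s ^+ 2 + 1) <= 1.
    by rewrite ler_pdivrMr// mul1r lerDl.
  by move: (_ / (_ + 1)) => q q1; nra.
have [a00|an] := eqVneq a 0.
  rewrite a00 mulr0 mul0r; apply: (small b b0) => t t0.
  have ti : 0 < t^-1 by rewrite invr_gt0.
  by have := ht _ ti; rewrite a00 invrK expr0n /= mulr0 add0r.
have [b00|bn] := eqVneq b 0.
  rewrite b00 mulr0; apply: (small a a0) => t t0.
  by have := ht _ t0; rewrite b00 expr0n /= mulr0 addr0.
have := ht (b / a) (divr_gt0 _ _); rewrite !lt_def bn an b0 a0 => /(_ isT isT).
rewrite (_ : k / 2 * _ = k * a * b)//; field; exact/andP.
Qed.

(** * Unitary change of basis *)

Section Unitary.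
Context (V : 'M[C]_n) (VV : V *m V^t* = 1%:M).

Let VV' : V^t* *m V = 1%:M.
Proof. exact: mulmx1C. Qed.

Definition conjby A := V *m A *m V^t*.

Lemma conjbyK A : V^t* *m conjby A *m V = A.
Proof. by rewrite /conjby !mulmxA VV' mul1mx -mulmxA VV' mulmx1. Qed.

Lemma conjbyM A B : conjby (A *m B) = conjby A *m conjby B.
Proof. by rewrite /conjby !mulmxA -(mulmxA _ (V^t*) V) VV' mulmx1. Qed.

Lemma conjby1 : conjby 1%:M = 1%:M.
Proof. by rewrite /conjby mulmx1. Qed.

Lemma conjbyD A B : conjby (A + B) = conjby A + conjby B.
Proof. by rewrite /conjby mulmxDr mulmxDl. Qed.

Lemma conjbyB A B : conjby (A - B) = conjby A - conjby B.
Proof. by rewrite /conjby mulmxBr mulmxBl. Qed.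

Lemma conjbyZ c A : conjby (c *: A) = c *: conjby A.
Proof. by rewrite /conjby -scalemxAr -scalemxAl. Qed.

Lemma conjbyX A m : conjby (A ^+ m) = conjby A ^+ m.
Proof.
by elim: m => [|m IH]; rewrite ?expr0 ?conjby1// !mulmxXS conjbyM IH.
Qed.

Lemma conjby_adj A : (conjby A)^t* = conjby (A^t*).
Proof. by rewrite /conjby !adjM adjK mulmxA. Qed.

Lemma sqnorm_unitary x : sqnorm (V *m x) = sqnorm x.
Proof. by rewrite !sqnorm_dotc dotc_adj mulmxA VV' mul1mx. Qed.

Lemma sqnorm_unitary_adj x : sqnorm (V^t* *m x) = sqnorm x.
Proof. by rewrite -sqnorm_unitary mulmxA VV mul1mx. Qed.

Lemma dotc_conjby A x y : dotc x (conjby A *m y) = dotc (V^t* *m x) (A *m (V^t* *m y)).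
Proof. by rewrite -dotc_adj /conjby !mulmxA. Qed.

Lemma defect_conjby A x : defect (conjby A) x = defect A (V^t* *m x).
Proof. by rewrite /defect /conjby -!mulmxA sqnorm_unitary sqnorm_unitary_adj. Qed.

Lemma contractive_conjby A : contractive A -> contractive (conjby A).
Proof. by move=> cA x; rewrite defect_conjby. Qed.

Lemma dbound_conjby k A B E : dbound k A B E -> dbound k (conjby A) (conjby B) (conjby E).
Proof. by move=> h x y; rewrite dotc_conjby /dnorm !defect_conjby; exact: h. Qed.

Lemma sv_chain_conjby kap (k : nat) Ws : sv_chain kap k Ws -> sv_chain kap k (fun i => conjby (Ws i)).
Proof.
move=> [h0 h]; split=> [|i ik]; first exact: contractive_conjby.
by have := dbound_conjby (h i ik); rewrite conjbyB -conjby_adj conjbyX.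
Qed.

Lemma contractive_diag_uball d : contractive (diag_mx d) -> uball d.
Proof.
move=> h i; have := h (\col_j (j == i)%:R); rewrite defect_diag (bigD1 i)//= big1.
  rewrite mxE eqxx modc1 expr1n mulr1 addr0 subr_ge0.
  by move=> hd; apply: ler_of_sqr => //; rewrite expr1n.
by move=> j ji; rewrite mxE (negbTE ji) modc0 expr0n /= mulr0.
Qed.

Definition udiag e := V^t* *m diag_mx e *m V.

Lemma conjby_udiag e : conjby (udiag e) = diag_mx e.
Proof. by rewrite /conjby /udiag !mulmxA VV mul1mx -mulmxA VV mulmx1. Qed.

Lemma conjby_inj : injective conjby.
Proof. by move=> A B e; rewrite -(conjbyK A) e conjbyK. Qed.

Lemma udiagM e e' : udiag e *m udiag e' = udiag (\row_i (e 0 i * e' 0 i)).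
Proof.
by apply: conjby_inj; rewrite conjbyM !conjby_udiag mulmx_diag.
Qed.

Lemma udiagX e m : udiag e ^+ m = udiag (pwmx e m).
Proof. by apply: conjby_inj; rewrite conjbyX !conjby_udiag diagX. Qed.

Lemma sub1_udiag e : 1%:M - udiag e = udiag (\row_i (1 - e 0 i)).
Proof.
apply: conjby_inj; rewrite conjbyB conjby1 !conjby_udiag.
apply/matrixP => i j; rewrite !mxE.
by case: eqVneq => [->|_]; rewrite ?mulr1n// !mulr0n subrr.
Qed.

Lemma udiag_adj e : (udiag e)^t* = udiag (map_mx (fun z : C => z^*) e).
Proof.
by apply: conjby_inj; rewrite -conjby_adj !conjby_udiag diag_adj.
Qed.

Lemma pinv_udiag e (A := 1%:M - udiag e) (Q := udiag (inv1B e)) :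
  [/\ A *m Q *m A = A, Q *m A *m Q = Q, (A *m Q)^t* = A *m Q &
      (Q *m A)^t* = Q *m A].
Proof.
rewrite /A /Q sub1_udiag !udiagM !udiag_adj.
split; congr udiag; apply/rowP => i; rewrite !mxE.
- have [->|en] := eqVneq (1 - e 0 i) 0; first by rewrite mulr0.
  by rewrite divff// mul1r.
- have [->|en] := eqVneq (1 - e 0 i) 0; first by rewrite invr0 mulr0.
  by rewrite mulVf// mul1r.
- have [->|en] := eqVneq (1 - e 0 i) 0; first by rewrite mul0r rmorph0.
  by rewrite divff// rmorph1.
- have [->|en] := eqVneq (1 - e 0 i) 0; first by rewrite mulr0 rmorph0.
  by rewrite mulVf// rmorph1.
Qed.

(** Conjugation by V makes W diagonal and preserves norms and defects, so [core_bound] applies;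
    testing it against the image vector itself converts the bilinear bound into a norm bound. *)
Theorem unitary_core_bound (kap : R) (k : nat) (Ws Ps : nat -> 'M[C]_n)
    (d f fk : 'rV[C]_n) (cK : R) :
  0 <= kap -> k%:R * kap <= 1 / 8 -> sv_chain kap k Ws -> Ws 0%N = udiag d ->
  (forall i, f 0 i ^+ 2 = 1 - d 0 i) ->
  (forall i, fk 0 i ^+ 2 = 1 - d 0 i ^+ (2 ^ k)) -> 0 <= cK ->
  (forall x, sqnorm (udiag fk *m (Ps k - udiag (inv1B (pwmx d (2 ^ k)))) *m udiag fk *m x) <=
     cK ^+ 2 * sqnorm x) ->
  (forall i, (i < k)%N ->
     Ps i = 2^-1 *: (1%:M + (1%:M + Ws i) *m Ps i.+1 *m (1%:M + Ws i))) ->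
  forall x, sqnorm (udiag f *m (Ps 0%N - udiag (inv1B d)) *m udiag f *m x) <=
    (core_const * (cK + 1584 * k%:R * (k%:R * kap))) ^+ 2 * sqnorm x.
Proof.
move=> kap0 kapk hW W0 fE fkE cK0 hK PS x.
set T := udiag f *m _ *m udiag f.
set c := core_const * _.
have c0 : 0 <= c by rewrite mulr_ge0 ?(ltW core_const_gt0)// addr_ge0// !mulr_ge0.
pose v := V *m x.
have hv : sqnorm (conjby T *m v) <= (c * Num.sqrt (sqnorm v)) ^+ 2.
  apply: sqnorm_dbound; first by rewrite mulr_ge0 ?sqrtr_ge0.
  rewrite mulrAC -mulrA.
  have -> : conjby T = diag_mx f *m (conjby (Ps 0%N) - diag_mx (inv1B (pwmx d (2 ^ 0))))
     *m diag_mx f.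
    have -> : pwmx d (2 ^ 0) = d by apply/rowP => i; rewrite mxE expn0 expr1.
    by rewrite /T (conjbyM (udiag f *m _)) (conjbyM (udiag f)) conjbyB !conjby_udiag.
  have W0' : conjby (Ws 0%N) = diag_mx d by rewrite W0 conjby_udiag.
  apply: (@core_bound kap k (fun i => conjby (Ws i)) (fun i => conjby (Ps i)) d f fk) => //.
  - exact: sv_chain_conjby.
  - by apply: contractive_diag_uball; rewrite -W0'; apply: contractive_conjby; case: hW.
  - by move=> i; rewrite -modcX fE.
  - by move=> i; rewrite -modcX fkE /gap mxE.
  - move=> z w; apply: le_trans (modc_dotc_le _ _) _.
    have -> : diag_mx fk *m (conjby (Ps k) - diag_mx (inv1B (pwmx d (2 ^ k)))) *m
        diag_mx fk *m w = V *m (udiag fk *m (Ps k - udiag (inv1B (pwmx d (2 ^ k)))) *m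
          udiag fk *m (V^t* *m w)).
      by rewrite -!conjby_udiag -conjbyB -!conjbyM /conjby !mulmxA.
    rewrite sqnorm_unitary mulrCA; apply: ler_wpM2l; first exact: sqrtr_ge0.
    apply: ler_of_sqr; first by rewrite mulr_ge0 ?sqrtr_ge0.
    rewrite exprMn !sqr_sqrtr ?sqnorm_ge0//.
    by apply: le_trans (hK _) _; rewrite sqnorm_unitary_adj.
  - move=> i ik; rewrite {1}(PS i ik) conjbyZ conjbyD !conjbyM.
    by rewrite !conjbyD !conjby1.
move: hv; rewrite exprMn sqr_sqrtr ?sqnorm_ge0// /v sqnorm_unitary.
by rewrite /conjby -!mulmxA (mulmxA (V^t*) V) VV' mul1mx sqnorm_unitary !mulmxA.
Qed.

(** With W = udiag d, (I - W)^(1/2) (I - W)^+ (I - W) = (I - W)^(1/2), because f vanishes where I -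
    W does. This intertwining underlies the equality of the two norms. *)
Lemma sandwich_intertwine (Q : 'M[C]_n) (d f : 'rV[C]_n) :
  (forall i, f 0 i ^+ 2 = 1 - d 0 i) ->
  udiag f *m (Q *m (1%:M - udiag d) - 1%:M) =
    (udiag f *m (Q - udiag (inv1B d)) *m udiag f) *m udiag f.
Proof.
move=> fE.
have ff : udiag f *m udiag f = udiag (\row_i (1 - d 0 i)).
  by rewrite udiagM; congr udiag; apply/rowP => i; rewrite !mxE -fE.
have fq : udiag f *m udiag (inv1B d) *m udiag (\row_i (1 - d 0 i)) = udiag f.
  rewrite !udiagM; congr udiag; apply/rowP => i; rewrite !mxE -fE.
  have [->|fn] := eqVneq (f 0 i) 0; first by rewrite !mul0r.
  by rewrite mulfVK// expf_neq0.
by rewrite -[RHS]mulmxA ff sub1_udiag mulmxBr mulmxBr mulmxBl mulmx1 fq mulmxA.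
Qed.

(** Take x to be the pseudoinverse of udiag f applied to y: then udiag f x is the orthogonal
    projection of y onto the range of udiag f. *)
Lemma range_witness (f : 'rV[C]_n) y : exists2 x,
  udiag f *m (udiag f *m x) = udiag f *m y & sqnorm (udiag f *m x) <= sqnorm y.
Proof.
exists (udiag (\row_i (f 0 i)^-1) *m y).
  rewrite (mulmxA (udiag f) _ y) udiagM (mulmxA (udiag f) _ y) udiagM.
  congr (udiag _ *m y); apply/rowP => i; rewrite !mxE.
  have [->|fn] := eqVneq (f 0 i) 0; first by rewrite !mul0r.
  by rewrite mulrA mulfK.
rewrite (mulmxA (udiag f) _ y) udiagM /udiag -!mulmxA sqnorm_unitary_adj -[sqnorm y]sqnorm_unitary.
apply: ler_sum => i _; rewrite diag_mulE !mxE modcM exprMn.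
apply: ler_piMl; first exact: sqr_ge0.
have [->|fn] := eqVneq (f 0 i) 0; first by rewrite mul0r modc0 expr0n.
by rewrite divff// modc1 expr1n.
Qed.

End Unitary.

End Vectors.

End Energy.

From mathcomp Require Import complex.
From mathcomp Require Import all_classical all_reals ereal.

Local Open Scope complex_scope.
Local Open Scope sesquilinear_scope.

(** * Weighted norms and square roots over R[i] *)

Section ComplexCase.
Context (R : realType).
Local Notation C := R[i].
Local Notation re := (@complex.Re R).
Local Notation toC := (real_complex R : {rmorphism R -> C}).
Local Notation sqnorm := (sqnorm re).
Local Notation defect := (defect re).

Let toC_le : forall x y : R, (toC x <= toC y) = (x <= y).
Proof. exact: lecR. Qed.

Let toC_re : forall z : C, toC (re z) = 'Re z.
Proof. exact: complexRe. Qed.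

Lemma qformE n (F : 'M[C]_n) x : qform F x = dotc x (F *m x).
Proof. by rewrite /qform -mulmxA. Qed.

Lemma wnorm_gram n (S : 'M[C]_n) x :
  wnorm (S^t* *m S) x = Num.sqrt (sqnorm (S *m x)).
Proof.
by rewrite /wnorm qformE -mulmxA dotc_adj adjK (sqnorm_dotc toC_le toC_re).
Qed.

Lemma wnorm1 n (x : 'cV[C]_n) : wnorm 1%:M x = Num.sqrt (sqnorm x).
Proof. by rewrite /wnorm qformE mul1mx (sqnorm_dotc toC_le toC_re). Qed.

Lemma sqnorm_gt0 n (x : 'cV[C]_n) : x != 0 -> 0 < sqnorm x.
Proof.
move=> xn; rewrite lt_def sqnorm_ge0 andbT; apply: contra_neq xn.
exact: (sqnorm_eq0 toC_re).
Qed.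

Lemma EFin_div_sqrt (a b : R) : 0 < b ->
  ((Num.sqrt a)%:E / (Num.sqrt b)%:E)%E = (Num.sqrt a / Num.sqrt b)%:E.
Proof. by move=> b0; rewrite inver gt_eqF ?sqrtr_gt0// -EFinM. Qed.

Lemma specnorm_le_sqnorm n (M : 'M[C]_n) (c : R) x : (specnorm M <= c%:E)%E ->
  sqnorm (M *m x) <= c ^+ 2 * sqnorm x.
Proof.
have [->|xn] := eqVneq x 0.
  by rewrite mulmx0 (sqnorm_0 toC_le toC_re) mulr0.
move=> h; have x0 := sqnorm_gt0 xn.
have : ((Num.sqrt (sqnorm (M *m x)) / Num.sqrt (sqnorm x))%:E <= c%:E)%E.
  apply: le_trans h; rewrite -EFin_div_sqrt// -!wnorm1.
  by apply: ereal_sup_ubound; exists x.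
rewrite lee_fin ler_pdivrMr ?sqrtr_gt0// => h1.
rewrite -(sqr_sqrtr (sqnorm_ge0 re x)) -(sqr_sqrtr (sqnorm_ge0 re (M *m x))) -exprMn.
by apply: lerXn2r; rewrite // nnegrE ?sqrtr_ge0// (le_trans _ h1) ?sqrtr_ge0.
Qed.

(** A nonzero vector is supplied because for n = 0 the supremum is -oo and says nothing about c. *)
Lemma specnorm_ge0 n (M : 'M[C]_n) (c : R) (x : 'cV[C]_n) : x != 0 ->
  (specnorm M <= c%:E)%E -> 0 <= c.
Proof.
move=> xn h; have x0 := sqnorm_gt0 xn.
have : ((Num.sqrt (sqnorm (M *m x)) / Num.sqrt (sqnorm x))%:E <= c%:E)%E.
  apply: le_trans h; rewrite -EFin_div_sqrt// -!wnorm1.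
  by apply: ereal_sup_ubound; exists x.
by rewrite lee_fin; apply: le_trans; rewrite divr_ge0 ?sqrtr_ge0.
Qed.

Lemma specnorm_leI n (M : 'M[C]_n) (c : R) :
  (forall x, x != 0 -> 0 <= c /\ sqnorm (M *m x) <= c ^+ 2 * sqnorm x) ->
  (specnorm M <= c%:E)%E.
Proof.
move=> h; apply: ge_ereal_sup => _ [x /= xn <-].
rewrite !wnorm1 EFin_div_sqrt ?sqnorm_gt0// lee_fin ler_pdivrMr ?sqrtr_gt0 ?sqnorm_gt0//.
have [cx hx] := h x xn; apply: ler_of_sqr; first by rewrite mulr_ge0 ?sqrtr_ge0.
by rewrite exprMn !sqr_sqrtr ?sqnorm_ge0.
Qed.

(** The weighted quotient of M at x is the quotient of T at Sx, which gives one inequality.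
    Conversely, each x has a y with TSy = Tx and ||Sy|| <= ||x||, so the quotient of T at x is
    dominated. *)
Lemma wmxnorm_gram_intertwine n (S M T : 'M[C]_n) :
  S *m M = T *m S ->
  (forall y, exists2 x, T *m (S *m x) = T *m y & sqnorm (S *m x) <= sqnorm y) ->
  wmxnorm (S^t* *m S) M = specnorm T.
Proof.
move=> SM wit.
have SMx x : S *m (M *m x) = T *m (S *m x) by rewrite mulmxA SM mulmxA.
have ratio_ge0 (a b : R) : (0 <= (Num.sqrt a)%:E / (Num.sqrt b)%:E)%E.
  by rewrite mule_ge0 ?inve_ge0 ?lee_fin ?sqrtr_ge0.
have N20 m : sqnorm (0 : 'cV[C]_m) = 0 by exact: (sqnorm_0 toC_le toC_re).
apply/eqP; rewrite eq_le; apply/andP; split; apply: ge_ereal_sup => _ [x /= xn <-].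
  (* If Sx = 0 the quotient is 0/0 = 0, below any quotient of T. *)
  rewrite !wnorm_gram SMx; have [Sx0|Sxn] := eqVneq (S *m x) 0.
    rewrite Sx0 mulmx0 !N20 sqrtr0 mul0e.
    apply: le_trans (ratio_ge0 (sqnorm (T *m x)) (sqnorm x)) _; rewrite -!wnorm1.
    by apply: ereal_sup_ubound; exists x.
  by rewrite -!wnorm1; apply: ereal_sup_ubound; exists (S *m x).
have [y Ty yx] := wit x; rewrite !wnorm1 -Ty.
have [Sy0|Syn] := eqVneq (S *m y) 0.
  rewrite Sy0 mulmx0 N20 sqrtr0 mul0e.
  apply: le_trans (ratio_ge0 (sqnorm (S *m (M *m x))) (sqnorm (S *m x))) _.
  by rewrite -!wnorm_gram; apply: ereal_sup_ubound; exists x.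
have yn : y != 0 by apply: contraNneq Syn => ->; rewrite mulmx0.
apply: (@le_trans _ _ ((Num.sqrt (sqnorm (S *m (M *m y))))%:E / (Num.sqrt (sqnorm (S *m y)))%:E)%E).
  rewrite SMx !EFin_div_sqrt ?sqnorm_gt0// lee_fin ler_wpM2l ?sqrtr_ge0//.
  by rewrite lef_pV2 ?posrE ?sqrtr_gt0 ?sqnorm_gt0// ler_wsqrtr.
by rewrite -!wnorm_gram; apply: ereal_sup_ubound; exists y.
Qed.

(** The semidefiniteness conditions say that N^* and N are contractive, and eps/4 times the sum of
    the defects is eps/2 times their mean. *)
Lemma normalized_sv_approx_dbound n (eps : R) (N' N : 'M[C]_n) :
  normalized_sv_approx eps N' N -> dbound re (eps / 2) (N^t*) N (N' - N).
Proof.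
move=> [psd1 psd2 h].
have q1 x : qform (1%:M - N *m N^t*) x = toC (defect (N^t*) x).
  exact: (qform_defect toC_le toC_re).
have q2 x : qform (1%:M - N^t* *m N) x = toC (defect N x).
  by have := qform_defect toC_le toC_re (N^t*) x; rewrite adjK.
have c1 : contractive re (N^t*) by move=> x; rewrite -toC_le -q1 rmorph0; exact: psd1.
have c2 : contractive re N by move=> x; rewrite -toC_le -q2 rmorph0; exact: psd2.
apply: (dbound_homogeneous toC_le toC_re c1 c2) => x y.
rewrite -toC_le (modcE toC_re) /dotc mulmxA.
apply: le_trans (h x y) _; rewrite q1 q2 -rmorphD -rmorphM.
by rewrite (_ : eps / 2 / 2 = eps / 4)//; field.
Qed.

Lemma specnorm_contractive n (W : 'M[C]_n) : (specnorm W <= 1)%E -> contractive re W.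
Proof.
move=> h x; rewrite subr_ge0; have := specnorm_le_sqnorm (c := 1) x h.
by rewrite expr1n mul1r.
Qed.

Lemma spectral_unitary n (W : 'M[C]_n) :
  spectralmx W *m (spectralmx W)^t* = 1%:M.
Proof. exact/unitarymxP/spectral_unitarymx. Qed.

Lemma spectral_udiag n (W : 'M[C]_n) : W \is normalmx ->
  W = udiag (spectralmx W) (spectral_diag W).
Proof.
move=> /orthomx_spectralP {1}->.
by rewrite invmx_unitary ?spectral_unitarymx.
Qed.

Lemma sqrt1Bmx_udiag n (V : 'M[C]_n) d : V *m V^t* = 1%:M ->
  sqrt1Bmx (udiag V d) = udiag V (map_mx (fun a => sqrtc (1 - a)) d).
Proof.
move=> VV; have Vu : V^t* \is unitarymx by rewrite trmxC_unitary; exact/unitarymxP.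
rewrite (sqrt1BmxE (d := d) Vu); last by rewrite adjK.
by rewrite adjK.
Qed.

Lemma pseudoinverse_sub1_udiag n (V : 'M[C]_n) d : V *m V^t* = 1%:M ->
  pseudoinverse (1%:M - udiag V d) = udiag V (inv1B d).
Proof.
move=> VV; apply: is_pseudoinverse_unique (pseudoinverseP _) _.
exact: pinv_udiag.
Qed.

End ComplexCase.

(** * Assembly of the final estimate *)

Theorem mainTheorem10 :
  forall (R : realType) (C : R), 0 < C ->
  exists C' : R, 0 < C' /\
  forall (n : nat) (W : 'M[R[i]]_n) (k : nat) (eps : R)
         (Ws P : nat -> 'M[R[i]]_n),
    W \is normalmx ->
    (specnorm W <= 1)%E ->
    (1 <= k)%N ->
    eps <= 1 / (4 * k%:R) ->
    Ws 0%N = W ->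
    (forall i : nat, (1 <= i < k)%N ->
       normalized_sv_approx eps (Ws i) (Ws i.-1 ^+ 2)) ->
    (specnorm (sqrt1Bmx (W ^+ (2 ^ k)) *m
               (P k - pseudoinverse (1%:M - W ^+ (2 ^ k))) *m
               sqrt1Bmx (W ^+ (2 ^ k)))
       <= (C * (k%:R * eps))%:E)%E ->
    (forall i : nat, (i < k)%N ->
       P i = 2^-1 *: (1%:M + (1%:M + Ws i) *m P i.+1 *m (1%:M + Ws i))) ->
    let SW := sqrt1Bmx W in
    let B := SW^t* *m SW in
    wmxnorm B (P 0%N *m (1%:M - W) - 1%:M) =
      specnorm (SW *m (P 0%N - pseudoinverse (1%:M - W)) *m SW) /\
    (specnorm (SW *m (P 0%N - pseudoinverse (1%:M - W)) *m SW)
       <= (C' * (k%:R ^+ 2 * eps))%:E)%E.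
Proof.
move=> R C C0.
have := core_const_gt0 R; set M := core_const R => M0.
(* With kap = eps/2, the term 1584 k (k kap) is 792 k^2 eps. *)
exists (M * (C + 792)).
split.
  apply: mulr_gt0; first exact: M0.
  apply: addr_gt0; first exact: C0.
  by rewrite ltr0n.
move=> n W k eps Ws P nW W1 k1 epsk W0 hW hP PS SW B.
have toC_le (x y : R) : (real_complex R x <= real_complex R y) = (x <= y).
  exact: lecR.
have toC_re (z : R[i]) : real_complex R (complex.Re z) = 'Re z.
  exact: complexRe.
have [V [d [VV WE]]] : exists V d, V *m V^t* = 1%:M /\ W = udiag V d.
  exists (spectralmx W), (spectral_diag W).
  by split; [exact: spectral_unitary | exact: spectral_udiag].
have fE i : (map_mx (fun a : R[i] => sqrtc (1 - a)) d) 0 i ^+ 2 = 1 - d 0 i.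
  by rewrite mxE sqr_sqrtc.
have fkE i : (map_mx (fun a : R[i] => sqrtc (1 - a)) (pwmx d (2 ^ k))) 0 i ^+ 2 =
    1 - d 0 i ^+ (2 ^ k).
  by rewrite !mxE sqr_sqrtc.
have SE : sqrt1Bmx W = udiag V (map_mx (fun a : R[i] => sqrtc (1 - a)) d).
  by rewrite WE; exact: sqrt1Bmx_udiag.
have QE : pseudoinverse (1%:M - W) = udiag V (inv1B d).
  by rewrite WE; exact: pseudoinverse_sub1_udiag.
have XE : W ^+ (2 ^ k) = udiag V (pwmx d (2 ^ k)).
  by rewrite WE; exact: udiagX.
move: hP; rewrite XE (sqrt1Bmx_udiag (pwmx d (2 ^ k)) VV).
rewrite (pseudoinverse_sub1_udiag (pwmx d (2 ^ k)) VV).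
rewrite /B /SW SE QE; move: fE fkE {SE QE XE B SW}.
(* The square roots become diagonals with f_i^2 = 1 - d_i and fk_i^2 = 1 - d_i^(2^k). *)
move: (map_mx _ d) (map_mx _ (pwmx d (2 ^ k))) => f fk fE fkE hP.
split.
  apply: wmxnorm_gram_intertwine; first by rewrite WE; exact: (sandwich_intertwine VV _ fE).
  move=> y; have [x xy xle] := range_witness toC_le toC_re VV f y.
  by exists x => //; rewrite -[LHS]mulmxA -[RHS]mulmxA xy.
apply: specnorm_leI => x xn.
have k0 : 0 < k%:R :> R by rewrite ltr0n.
(* As x is nonzero, the hypothesis on P_k bounds a nonnegative number, which yields eps >= 0. *)
have Ck0 : 0 <= C * (k%:R * eps) by exact: specnorm_ge0 xn hP.
have eps0 : 0 <= eps by move: Ck0; rewrite pmulr_rge0// pmulr_rge0.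
have kk : k%:R * (eps / 2) <= 1 / 8.
  have := ler_wpM2l (ltW k0) epsk.
  have -> : k%:R * (1 / (4 * k%:R)) = 1 / 4 :> R by field; rewrite gt_eqF.
  by move: (k%:R) => t; lra.
have C2 : 0 <= C + 792 by apply: addr_ge0; [exact: ltW | rewrite ler0n].
have k2 : 0 <= k%:R ^+ 2 * eps by apply: mulr_ge0 eps0; exact: sqr_ge0.
have MC : 0 <= M * (C + 792) * (k%:R ^+ 2 * eps).
  by apply: mulr_ge0 k2; exact: mulr_ge0 (ltW M0) C2.
split; first exact: MC.
have hsva : sv_chain (@complex.Re R) (eps / 2) k Ws.
  split; first by rewrite W0; exact: specnorm_contractive W1.
  move=> i ik; apply: normalized_sv_approx_dbound; exact: (hW i.+1).
have hk y : _ := specnorm_le_sqnorm y hP.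
have eps20 : 0 <= eps / 2 by rewrite divr_ge0.
rewrite WE in W0.
have := unitary_core_bound toC_le toC_re VV eps20 kk hsva W0 fE fkE Ck0 hk PS x.
move=> /le_trans; apply.
apply: ler_wpM2r; first exact: sqnorm_ge0.
(* As k >= 1, the error C k eps of P_k is at most C k^2 eps. *)
have c1 : C * (k%:R * eps) + 1584 * k%:R * (k%:R * (eps / 2)) <=
    (C + 792) * (k%:R ^+ 2 * eps).
  have : k%:R * eps <= k%:R ^+ 2 * eps.
    by apply: ler_wpM2r => //; rewrite expr2 ler_peMl ?(ltW k0)// ler1n.
  move=> /(ler_wpM2l (ltW C0)); move: (C * _) => t; lra.
have c0 : 0 <= C * (k%:R * eps) + 1584 * k%:R * (k%:R * (eps / 2)).
  apply: addr_ge0 Ck0 _; apply: mulr_ge0; first by rewrite mulr_ge0 ?ler0n.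
  by apply: mulr_ge0 eps20; exact: ltW.
apply: lerXn2r; rewrite ?nnegrE.
- exact: mulr_ge0 (ltW M0) c0.
- exact: MC.
- by rewrite -[leRHS]mulrA; apply: ler_wpM2l c1; exact: ltW M0.
Qed.
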